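(* There is an algorithm which, given an integer $K\ge 3$, real numbers $a_1,\dots,a_K,b_1,\dots,b_K$ and a choice of sign $\pm$, computes a real symmetric tridiagonal $K\times K$ matrix that is orthogonally similar to $\mathbf{J}_\pm$ (and hence has the same eigenvalues as $\mathbf{J}_\pm$) using $O(K^2)$ operations and $O(K)$ storage, where $\mathbf{J}_\pm$ is the $K\times K$ real symmetric matrix with entries $(\mathbf{J}_\pm)_{j,j} = b_j$ for $1\le j\le K$; $(\mathbf{J}_\pm)_{j,j+1} = (\mathbf{J}_\pm)_{j+1,j} = a_j$ for $1\le j\le K-1$; $(\mathbf{J}_\pm)_{1,K} = (\mathbf{J}_\pm)_{K,1} = \pm a_K$; and all other entries zero. The constants implied by $O(\cdot)$ are absolute, i.e. independent of $K$ and of the real data.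
   Context: Operations are counted in the real-arithmetic model: each operation is an addition, subtraction, multiplication, division, square root, or comparison of real numbers, and storage counts the number of real numbers (and indices) held simultaneously. A matrix is tridiagonal if all its entries $(j,k)$ with $|j-k|>1$ are zero. The matrices $\mathbf{J}_+$ and $\mathbf{J}_-$ are those whose eigenvalues give the endpoints of the $K$ intervals forming the spectrum of the period-$K$ Jacobi operator $(\mathcal{J}\psi)_n = a_{n-1}\psi_{n-1}+b_n\psi_n+a_n\psi_{n+1}$ on $\ell^2(\mathbb{Z})$ with $a_{n+K}=a_n$, $b_{n+K}=b_n$. *)

(* Defs.v *)
From mathcomp Require Import all_boot all_order all_algebra.
From mathcomp Require Import finmap reals.

Set Implicit Arguments.
Unset Strict Implicit.
Unset Printing Implicit Defensive.

Import Order.TTheory GRing.Theory Num.Theory.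
Local Open Scope ring_scope.
Local Open Scope fmap_scope.

(* Real-arithmetic machine.  A program is a finite text that mentions neither
   the order K nor the real data.  It manipulates index variables, holding
   natural numbers, and the cells of real arrays; variables and arrays are
   named by natural numbers. *)

Inductive iexp : Type :=
| IConst of nat
| IVar of nat
| IAdd of iexp & iexp
| ISub of iexp & iexp.

(* [Cell x e] is the real cell x[e]. *)
Inductive loc : Type := Cell of nat & iexp.

Inductive rop : Type := Add | Sub | Mul | Div.

(* Each instruction or test contains at most one real operation. *)
Inductive instr : Type :=
| RConst of loc & nat              (* x := n *)
| RMove of loc & loc               (* x := y *)
| ROp of rop & loc & loc & loc     (* x := y op z *)
| RSqrt of loc & loc               (* x := sqrt y *)
| ISet of nat & iexp.              (* i := e *)

Inductive test : Type :=
| RLt of loc & loc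
| REq of loc & loc
| ILt of iexp & iexp
| IEq of iexp & iexp.

Inductive cmd : Type :=
| Skip
| Do of instr
| Seq of cmd & cmd
| If of test & cmd & cmd
| While of test & cmd.

(* The domains of the two maps are the cells and variables currently in use;
   reading outside them is an error. *)
Record state (R : realType) : Type := State {
  rmem : {fmap nat * nat -> R};
  imem : {fmap nat -> nat}
}.

Section Semantics.
Variable R : realType.
Implicit Types (s : state R) (e : iexp) (x y z : loc) (M n : nat).

Fixpoint ieval s e : option nat :=
  match e with
  | IConst n => Some n
  | IVar i => (imem s).[? i]
  | IAdd e1 e2 =>
      if (ieval s e1, ieval s e2) is (Some u, Some v) then Some (u + v)%N
      else None
  | ISub e1 e2 =>
      if (ieval s e1, ieval s e2) is (Some u, Some v) then Some (u - v)%N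
      else None
  end.

Definition laddr s x : option (nat * nat) :=
  let: Cell t e := x in if ieval s e is Some k then Some (t, k) else None.

Definition rread s x : option R :=
  if laddr s x is Some c then (rmem s).[? c] else None.

Definition rwrite s x (v : R) : option (state R) :=
  if laddr s x is Some c then Some (State (rmem s).[c <- v] (imem s))
  else None.

(* Division by zero is an error, unlike in the library's total inverse. *)
Definition rop_eval (o : rop) (u v : R) : option R :=
  match o with
  | Add => Some (u + v)
  | Sub => Some (u - v)
  | Mul => Some (u * v)
  | Div => if v == 0 then None else Some (u / v)
  end.

(* So is the square root of a negative number. *)
Definition sqrt_eval (u : R) : option R :=
  if u < 0 then None else Some (Num.sqrt u).

Definition instr_eval (c : instr) s : option (state R) :=
  match c with
  | RConst x n => rwrite s x n%:R
  | RMove x y => if rread s y is Some u then rwrite s x u else None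
  | ROp o x y z =>
      if (rread s y, rread s z) is (Some u, Some v) then
        if rop_eval o u v is Some w then rwrite s x w else None
      else None
  | RSqrt x y =>
      if rread s y is Some u then
        if sqrt_eval u is Some w then rwrite s x w else None
      else None
  | ISet i e =>
      if ieval s e is Some k then Some (State (rmem s) (imem s).[i <- k])
      else None
  end.

Definition test_eval (t : test) s : option bool :=
  match t with
  | RLt x y =>
      if (rread s x, rread s y) is (Some u, Some v) then Some (u < v) else None
  | REq x y =>
      if (rread s x, rread s y) is (Some u, Some v) then Some (u == v) else None
  | ILt e1 e2 =>
      if (ieval s e1, ieval s e2) is (Some u, Some v) then Some (u < v)%N
      else None
  | IEq e1 e2 =>
      if (ieval s e1, ieval s e2) is (Some u, Some v) then Some (u == v)
      else None
  end.

Definition storage s : nat := (#|` domf (rmem s)| + #|` domf (imem s)|)%N.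

(* The values of the indices are bounded too, so that an index cannot encode
   an unbounded amount of information. *)
Definition fits M s : Prop :=
  (storage s <= M)%N /\ (forall i v, (imem s).[? i] = Some v -> (v <= M)%N).

(* [exec M c s n s']: started in s, the command c terminates without error in
   s' after n operations, every state reached on the way fitting in M.  Every
   instruction and every test is charged, including the moves and the index
   instructions; n thus bounds the number of real operations from above. *)
Inductive exec M : cmd -> state R -> nat -> state R -> Prop :=
| ExecSkip s : exec M Skip s 0 s
| ExecDo c s s' : instr_eval c s = Some s' -> fits M s' -> exec M (Do c) s 1 s'
| ExecSeq c1 c2 s1 s2 s3 n1 n2 :
    exec M c1 s1 n1 s2 -> exec M c2 s2 n2 s3 ->
    exec M (Seq c1 c2) s1 (n1 + n2) s3
| ExecIf t c1 c2 s s' v n :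
    test_eval t s = Some v -> exec M (if v then c1 else c2) s n s' ->
    exec M (If t c1 c2) s n.+1 s'
| ExecWhileStop t c s :
    test_eval t s = Some false -> exec M (While t c) s 1 s
| ExecWhileLoop t c s1 s2 s3 n1 n2 :
    test_eval t s1 = Some true -> exec M c s1 n1 s2 ->
    exec M (While t c) s2 n2 s3 ->
    exec M (While t c) s1 (n1 + n2).+1 s3.

Definition runs M (p : cmd) s n s' : Prop := fits M s /\ exec M p s n s'.

End Semantics.

Section Matrices.
Variables (R : realType) (K : nat).
Implicit Types (a b : 'I_K -> R) (neg : bool) (T A : 'M[R]_K).

(* Rows and columns are numbered from 0, so a i and b i are the a_(i+1) and
   b_(i+1) of the usual numbering.  The boolean selects the sign: J_+ for
   false, J_- for true.  At a corner, the larger of i and j is K - 1, so that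
   a i, resp. a j, is a_K. *)
Definition Jmx a b neg : 'M[R]_K :=
  \matrix_(i, j)
    if i == j then b i
    else if j == i.+1 :> nat then a i
    else if i == j.+1 :> nat then a j
    else if (i == 0%N :> nat) && (j == K.-1 :> nat) then (-1) ^+ neg * a j
    else if (j == 0%N :> nat) && (i == K.-1 :> nat) then (-1) ^+ neg * a i
    else 0.

Definition tridiagonal T : Prop :=
  forall j k : 'I_K, 1 < `|j%:Z - k%:Z| -> T j k = 0.

Definition symmetric_mx T : Prop := T^T = T.

Definition orthogonal_mx (Q : 'M[R]_K) : Prop := Q^T *m Q = 1%:M.

Definition orthogonally_similar T A : Prop :=
  exists Q : 'M[R]_K, orthogonal_mx Q /\ T = Q^T *m A *m Q.

(* Input: a in array 0, b in array 1, K in index variable 0, and the sign in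
   index variable 1 (0 for +, 1 for -). *)
Definition input a b neg : state R :=
  State
    (foldr (fun (i : 'I_K) m => m.[(0%N, val i) <- a i].[(1%N, val i) <- b i])
       [fmap] (enum 'I_K))
    [fmap].[0%N <- K].[1%N <- nat_of_bool neg].

(* Output: the diagonal of T in array 2, its superdiagonal in array 3; they
   determine T when T is symmetric and tridiagonal. *)
Definition outputs (s : state R) T : Prop :=
  (forall i : 'I_K, (rmem s).[? (2%N, val i)] = Some (T i i)) /\
  (forall i j : 'I_K, j = i.+1 :> nat ->
     (rmem s).[? (3%N, val i)] = Some (T i j)).

End Matrices.

(* Main.v *)
Require Import Defs.
From mathcomp Require Import all_boot all_order all_algebra.
From mathcomp Require Import finmap reals zify ring.

Set Implicit Arguments.
Unset Strict Implicit.
Unset Printing Implicit Defensive.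

Import Order.TTheory GRing.Theory Num.Theory.
Local Open Scope ring_scope.

(** The periodic Jacobi matrix J couples index i to index i + 1 modulo K, with
    weights c_i which are the a_i except that the last one carries the sign.

    If some c_z vanishes, the cycle is cut there: numbering the indices from
    z + 1 on moves the zero coupling to the corner and leaves a tridiagonal
    matrix, whose entries are read off the input ([cut_mx_tridiagonal],
    [cut_mx_similar]).

    If no c_i vanishes, the Lanczos recurrence started at the basis vector e_0
    builds orthonormal vectors v_0, v_1, ... with
      v_i J = be_(i-1) v_(i-1) + al_i v_i + be_i v_(i+1),
    and J is tridiagonal in the basis v.  One step applies the sparse matrix J
    once and remembers only the last two vectors: linear time and storage.
    The difficulty is breakdown: J may have multiple eigenvalues, and then the
    recurrence closes up before K vectors are found.  A restart needs a new
    vector orthogonal to all earlier ones, which are no longer stored.  The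
    program therefore carries along one more vector r, the component of the
    next basis vector e_1 orthogonal to v_0, ..., v_j, updated by one
    projection per step, and restarts from r / |r| with be_j = 0.

    This restart vector is nonzero as long as fewer than K vectors are known
    ([breakdown_remainder]): at a breakdown with r = 0 the span of the v_i is
    J-invariant and contains e_0 and e_1.  Its orthogonal complement is
    J-invariant too, and its vectors x satisfy x_0 = x_1 = 0; as no c_i
    vanishes, the three-term recurrence gives x_2 = x_3 = ... = 0
    ([Jmx_cyclic_pair]), so the complement is zero.  [lanczos_step] and
    [lanczos_last] put this together into a loop invariant.

    On the side of the machine, the program begins by filling every cell and
    variable that it uses, so that from then on a state is a pair of total
    functions ([view]); the cells all have an index below K and the variables
    a value of at most K, whence the linear storage.  Loop-free code is
    evaluated symbolically ([reaches_denote]), loops are proved by invariants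
    ([reaches_for]), and both rules count operations: K outer iterations, each
    with three loops over one vector, give the quadratic bound. *)

(** * Orthogonal similarity *)

Section Similarity.
Variables (R : realType) (K : nat).
Implicit Types (T A Q : 'M[R]_K).

Lemma orthogonally_similar_char_poly T A :
  orthogonally_similar T A -> char_poly T = char_poly A.
Proof.
move=> [Q [QQ ->]].
have h : map_mx polyC (Q^T) *m map_mx polyC Q = 1%:M :> 'M[{poly R}]_K.
  by rewrite -map_mxM QQ map_mx1.
rewrite /char_poly /char_poly_mx !map_mxM.
have -> : 'X%:M - map_mx polyC Q^T *m map_mx polyC A *m map_mx polyC Q
   = map_mx polyC Q^T *m ('X%:M - map_mx polyC A) *m map_mx polyC Q.
  by rewrite mulmxBr mulmxBl scalar_mxC -(mulmxA 'X%:M) h mulmx1.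
by rewrite !det_mulmx mulrAC -det_mulmx h det1 mul1r.
Qed.

Lemma orthogonally_similar_eigenvalue T A x :
  orthogonally_similar T A -> eigenvalue T x = eigenvalue A x.
Proof.
by move=> h; rewrite !eigenvalue_root_char (orthogonally_similar_char_poly h).
Qed.

End Similarity.

(** * The Lanczos recurrence with restarts *)
Section Dot.
Variables (R : realFieldType) (n : nat).
Implicit Types (x y z : 'rV[R]_n) (A : 'M[R]_n).

Definition dot x y : R := (x *m y^T) 0 0.

Lemma dotE x y : dot x y = \sum_k x 0 k * y 0 k.
Proof. by rewrite /dot mxE; apply: eq_bigr => k _; rewrite mxE. Qed.

Lemma dotC x y : dot x y = dot y x.
Proof. by rewrite !dotE; apply: eq_bigr => k _; rewrite mulrC. Qed.

Lemma dotDl x y z : dot (x + y) z = dot x z + dot y z.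
Proof. by rewrite /dot mulmxDl mxE. Qed.

Lemma dotZl c x z : dot (c *: x) z = c * dot x z.
Proof. by rewrite /dot -scalemxAl mxE. Qed.

Lemma dotBl x y z : dot (x - y) z = dot x z - dot y z.
Proof. by rewrite -scaleN1r dotDl dotZl mulN1r. Qed.

Lemma dot0l z : dot 0 z = 0.
Proof. by rewrite /dot mul0mx mxE. Qed.

Lemma dotDr x y z : dot x (y + z) = dot x y + dot x z.
Proof. by rewrite dotC dotDl !(dotC x). Qed.

Lemma dotZr c x z : dot x (c *: z) = c * dot x z.
Proof. by rewrite dotC dotZl (dotC x). Qed.

Lemma dot0r z : dot z 0 = 0.
Proof. by rewrite dotC dot0l. Qed.

Definition dotl := (dotBl, dotDl, dotZl, dot0l).

Lemma dot_ge0 x : 0 <= dot x x.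
Proof. by rewrite dotE sumr_ge0 // => k _; rewrite -expr2 sqr_ge0. Qed.

Lemma dot_eq0 x : dot x x = 0 -> x = 0.
Proof.
rewrite dotE => /eqP; rewrite psumr_eq0; last first.
  by move=> k _; rewrite -expr2 sqr_ge0.
move=> /allP h; apply/rowP => k; rewrite mxE.
by have := h k (mem_index_enum _); rewrite /= mulf_eq0 orbb => /eqP.
Qed.

Lemma dot_delta x k : dot x (delta_mx 0 k) = x 0 k.
Proof.
rewrite dotE (bigD1 k) //= mxE !eqxx mulr1 big1 ?addr0 // => i ik.
by rewrite mxE (negbTE ik) andbF mulr0.
Qed.

Lemma dot_mulmx A x y : A^T = A -> dot (x *m A) y = dot x (y *m A).
Proof. by move=> sA; rewrite /dot trmx_mul sA mulmxA. Qed.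

(** The linear system has fewer equations than unknowns. *)
Lemma exists_orthogonal m (v : nat -> 'rV[R]_n) : (m < n)%N ->
  exists2 x, x != 0 & forall i, (i < m)%N -> dot x (v i) = 0.
Proof.
move=> mn; pose B : 'M[R]_(n, m) := \matrix_(k, i) v i 0 k.
have kB : kermx B != 0.
  rewrite -mxrank_eq0 mxrank_ker subn_eq0 -ltnNge.
  by apply: leq_ltn_trans (rank_leq_col B) mn.
exists (nz_row (kermx B)); first by rewrite nz_row_eq0.
move=> i im; have /sub_kermxP := nz_row_sub (kermx B).
move/rowP/(_ (Ordinal im)); rewrite !mxE => <-.
by rewrite dotE; apply: eq_bigr => k _; rewrite !mxE.
Qed.

End Dot.

Section Lanczos.
Variables (R : rcfType) (n : nat) (J : 'M[R]_n) (e0 e1 : 'rV[R]_n).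
Hypothesis symJ : J^T = J.
Implicit Types (v : nat -> 'rV[R]_n) (al be : nat -> R) (p q r x : 'rV[R]_n).

(** The term of index i - 1 in the three-term recurrence, zero for i = 0. *)
Definition previous v be i : 'rV[R]_n :=
  if i is i'.+1 then be i' *: v i' else 0.

Definition orthonormal v m :=
  forall i k, (i < m)%N -> (k < m)%N -> dot (v i) (v k) = (i == k)%:R.

Definition recurrence v al be m :=
  forall i, (i < m)%N ->
    v i *m J = previous v be i + al i *: v i + be i *: v i.+1.

(** Membership in the span of v_0, ..., v_(m-1), expressed as membership in
    its double orthogonal complement. *)
Definition in_span v m x :=
  forall y, (forall i, (i < m)%N -> dot y (v i) = 0) -> dot y x = 0.

(** When J is symmetric, this says that the Krylov vectors of e0 and e1 together
    span the space. *)
Definition cyclic_pair :=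
  forall S : 'rV[R]_n -> Prop,
    (forall x, S x -> [/\ S (x *m J), dot x e0 = 0 & dot x e1 = 0]) ->
    forall x, S x -> x = 0.

(** Only the product [bet *: p] is tied to the history: after a restart [bet]
    is 0 and [p] is the last vector of the block just closed.  The vector [r]
    still has to be projected along the current vector [q], whence the bound
    j, not j + 1, in the last two fields. *)
Record lanczos_inv j v al be q p r (bet : R) : Prop := LanczosInv {
  li_orth : orthonormal v j.+1;
  li_rec : recurrence v al be j;
  li_init : v 0%N = e0;
  li_cur : v j = q;
  li_prev : bet *: p = previous v be j;
  li_res : forall i, (i < j)%N -> dot r (v i) = 0;
  li_span : in_span v j (e1 - r) }.

(** The recurrence is only asserted for the first n - 1 vectors; symmetry of J
    gives the last column, except for its diagonal entry. *)
Definition lanczos_done v al be :=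
  [/\ orthonormal v n, recurrence v al be n.-1 &
      forall i, i.+1 = n -> dot (v i *m J) (v i) = al i].

Lemma lanczos_start al be p :
  dot e0 e0 = 1 -> lanczos_inv 0 (fun=> e0) al be e0 p e1 0.
Proof.
move=> h; split=> //.
- by case=> [|i] [|k].
- by rewrite scale0r.
- by move=> y _; rewrite subrr dot0r.
Qed.

Section Step.
Variables (j : nat) (v : nat -> 'rV[R]_n) (al be : nat -> R).
Variables (q p r : 'rV[R]_n) (bet : R).
Hypothesis inv : lanczos_inv j v al be q p r bet.

Let u := q *m J - bet *: p.
Let alpha := dot u q.
Let w := u - alpha *: q.
Let rho := dot r q.
Let r' := r - rho *: q.

Let orth : orthonormal v j.+1 := li_orth inv.

Lemma dot_previous i : (i <= j)%N -> dot (previous v be j) (v i) =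
  if i.+1 == j then be i else 0.
Proof.
case: j orth => [|k] orth' ij /=; first by rewrite dot0l.
rewrite dotZl orth' //.
rewrite eqSS (eq_sym k); case: (eqVneq i k) => [->|ne] /=.
  by rewrite mulr1.
by rewrite mulr0.
Qed.

(** The previous vector may be subtracted before the diagonal coefficient is
    computed, since it is orthogonal to the current one. *)
Lemma alphaE : alpha = dot (q *m J) q.
Proof.
rewrite /alpha /u dotBl (li_prev inv) -(li_cur inv) dot_previous //.
by rewrite (gtn_eqF (ltnSn j)) subr0.
Qed.

(** For i < j the recurrence for v_i and the symmetry of J give
    <q J, v_i> = <q, v_i J> = be_(j-1) if i = j - 1 and 0 otherwise, which is
    what subtracting the previous term removes; the diagonal coefficient
    removes the component along v_j = q. *)
Lemma residual_orth i : (i <= j)%N -> dot w (v i) = 0.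
Proof.
move=> ij; have qq : dot q q = 1.
  by rewrite -(li_cur inv) orth // eqxx.
have [->|neij] := eqVneq i j.
  by rewrite (li_cur inv) /w dotBl dotZl -/alpha qq mulr1 subrr.
have lij : (i < j)%N by lia.
rewrite /w /u (li_prev inv) !dotl dot_previous // dot_mulmx //.
rewrite (li_rec inv lij) -(li_cur inv) !dotDr !dotZr !orth //; try lia.
rewrite (_ : dot (v j) (previous v be i) = 0); last first.
  case: i lij {ij neij} => [|i] lij /=; first by rewrite dot0r.
  by rewrite dotZr orth ?(gtn_eqF (ltnW lij)) ?mulr0 //; lia.
rewrite (gtn_eqF lij) (eq_sym j).
by case: (i.+1 == j); rewrite /=; ring.
Qed.

Lemma remainder_orth i : (i <= j)%N -> dot r' (v i) = 0.
Proof.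
move=> ij; rewrite /r' !dotl -{1}(li_cur inv) orth //.
have [->|neij] := eqVneq i j.
  by rewrite (li_cur inv) mulr1 subrr.
by rewrite (li_res inv) ?mulr0 ?subrr //; lia.
Qed.

Lemma remainder_span : in_span v j.+1 (e1 - r').
Proof.
move=> y yv; rewrite /r' opprB addrCA dotDr dotZr -{1}(li_cur inv) yv //.
rewrite mulr0 add0r; apply: (li_span inv) => i ij; apply: yv; lia.
Qed.

(** At the last vector the run is complete whatever the residual [w] is. *)
Lemma lanczos_last (al' be' : nat -> R) :
  j.+1 = n -> (forall i, (i < j)%N -> al' i = al i) -> al' j = alpha ->
  (forall i, (i < j)%N -> be' i = be i) ->
  lanczos_done v al' be'.
Proof.
move=> jn eal alj ebe; split.
- by rewrite -jn.
- rewrite -jn /= => i ij; rewrite (li_rec inv ij) eal // ebe //.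
  by case: i ij => //= i ij; rewrite ebe // ltnW.
- move=> i ij; have -> : i = j by apply: succn_inj; rewrite ij jn.
  by rewrite alj alphaE (li_cur inv).
Qed.

(** Otherwise the vectors orthogonal to v_0, ..., v_j would be stable under J
    and orthogonal to e0 = v_0 and to e1, hence all zero, although j + 1 < n. *)
Lemma breakdown_remainder : cyclic_pair -> (j.+1 < n)%N -> w = 0 ->
  r' != 0.
Proof.
move=> cyc jn w0; apply/eqP => r0.
have [x xn0 xv] := exists_orthogonal v jn.
case/eqP: xn0; pose S y := forall i, (i < j.+1)%N -> dot y (v i) = 0.
apply: (cyc S) => // y Sy; split.
- move=> i ij; rewrite dot_mulmx //.
  have hprev k : (k <= j)%N -> dot y (previous v be k) = 0.
    case: k => [|k] kj /=; first by rewrite dot0r.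
    by rewrite dotZr Sy ?mulr0 //; lia.
  have [->|neij] := eqVneq i j.
    have -> : v j *m J = previous v be j + alpha *: v j.
      rewrite -(li_prev inv) (li_cur inv); apply/eqP.
      by rewrite -subr_eq0 opprD addrA; apply/eqP.
    by rewrite dotDr dotZr hprev // Sy // mulr0 addr0.
  by rewrite (li_rec inv) ?dotDr ?dotZr ?hprev ?Sy ?mulr0 ?addr0 //; lia.
- by rewrite -(li_init inv) Sy.
- by have := remainder_span Sy; rewrite r0 subr0.
Qed.

(** Whether the next vector is the normalized residual or, after a breakdown,
    the normalized remainder, it is orthogonal to v_0, ..., v_j, and
    [bet' *: q' = w]: in the second case both sides vanish. *)
Lemma lanczos_step (al' be' : nat -> R) :
  let: brk := dot w w == 0 in
  let: d := Num.sqrt (if brk then dot r' r' else dot w w) in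
  let: q' := \row_k ((if brk then r' else w) 0 k / d) in
  let: bet' := if brk then 0 else d in
  cyclic_pair -> (j.+1 < n)%N ->
  (forall i, (i < j)%N -> al' i = al i) -> al' j = alpha ->
  (forall i, (i < j)%N -> be' i = be i) -> be' j = bet' ->
  d != 0 /\
  lanczos_inv j.+1 (fun i => if i == j.+1 then q' else v i) al' be' q' q r' bet'.
Proof.
move=> cyc jn eal alj ebe bej.
set brk := dot w w == 0 in bej *.
set d := Num.sqrt _ in bej *.
set q' := \row_k _; set bet' := if brk then 0 else d in bej *.
set z := if brk then r' else w.
have zE : (if brk then dot r' r' else dot w w) = dot z z.
  by rewrite /z; case: ifP.
have zgt0 : 0 < dot z z.
  rewrite lt_neqAle dot_ge0 andbT eq_sym; apply/negP => /eqP zz.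
  have [b|nb] := orP (orbN brk); last first.
    by move: zz; rewrite /z (negbTE nb) => zz; move: nb; rewrite /brk zz eqxx.
  have/eqP : z = 0 by apply: dot_eq0.
  rewrite /z b; apply/negP/breakdown_remainder => //.
  by apply: dot_eq0; apply/eqP.
have dd : d * d = dot z z.
  by rewrite -expr2 /d zE sqr_sqrtr // ltW.
have dn0 : d != 0.
  by apply: contraTneq zgt0 => d0; rewrite -dd d0 mulr0 ltxx.
have q'E : q' = d^-1 *: z by apply/rowP => k; rewrite !mxE mulrC.
have zv i : (i <= j)%N -> dot z (v i) = 0.
  by rewrite /z; case: ifP => _; [exact: remainder_orth|exact: residual_orth].
set v' := fun i => if i == j.+1 then q' else v i.
have v'E i : (i <= j)%N -> v' i = v i.
  by move=> ij; rewrite /v' (ltn_eqF (_ : i < j.+1)%N).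
have v'S : v' j.+1 = q' by rewrite /v' eqxx.
have pE i : (i <= j)%N -> previous v' be' i = previous v be i.
  by case: i => //= i ij; rewrite ebe ?v'E // ltnW.
have qv i : (i <= j)%N -> dot q' (v i) = 0.
  by move=> ij; rewrite q'E dotZl zv // mulr0.
have qq : dot q' q' = 1.
  by rewrite q'E dotZl dotZr -dd; field.
split=> //; split=> //.
- have: forall i k, (i <= k)%N -> (k < j.+2)%N ->
      dot (v' i) (v' k) = (i == k)%:R.
    move=> i k ik; rewrite ltnS leq_eqVlt => /predU1P[kj|kj]; last first.
      by rewrite !v'E ?orth //; lia.
    have [ij|ij] := eqVneq i j.+1; first by rewrite ij kj !v'S qq eqxx.
    rewrite kj v'S v'E; last by lia.
    by rewrite dotC qv ?(negbTE ij) //; lia.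
  move=> H i k ij kj; have [ik|/ltnW ki] := leqP i k; first exact: H.
  by rewrite dotC H // eq_sym.
- move=> i; rewrite ltnS leq_eqVlt => /predU1P[->|ij]; last first.
    by rewrite v'E ?pE ?eal ?ebe ?v'E ?(li_rec inv) // ltnW.
  rewrite v'E // pE // v'S alj bej -(li_prev inv) (li_cur inv).
  have -> : bet' *: q' = w.
    rewrite /bet'; have [b|nb] := orP (orbN brk).
      by rewrite b scale0r; apply/esym/dot_eq0/eqP.
    by rewrite (negbTE nb) q'E scalerA divff // scale1r /z (negbTE nb).
  by rewrite -addrA (addrC (_ *: q)) /w subrK /u addrC subrK.
- by rewrite v'E // (li_init inv).
- by rewrite /= bej v'E // (li_cur inv).
- by move=> i ij; rewrite v'E //; exact: remainder_orth.
- move=> y yv; apply: remainder_span => i ij.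
  by rewrite -v'E ?yv.
Qed.

End Step.

(** ** The tridiagonal matrix of a finished run *)
Section Done.
Variables (v : nat -> 'rV[R]_n) (al be : nat -> R).
Hypothesis fin : lanczos_done v al be.

Definition run_basis : 'M[R]_n := \matrix_(k, i) v i 0 k.

Lemma run_basis_orthogonal : run_basis^T *m run_basis = 1%:M.
Proof.
have [orth _ _] := fin; apply/matrixP => i k; rewrite !mxE.
rewrite -[RHS](orth i k) // dotE.
by apply: eq_bigr => l _; rewrite !mxE.
Qed.

Lemma run_matrixE i k :
  (run_basis^T *m J *m run_basis) i k = dot (v i *m J) (v k).
Proof.
rewrite dotE mxE; apply: eq_bigr => l _; rewrite !mxE; congr (_ * _).
by apply: eq_bigr => m _; rewrite !mxE.
Qed.

(** The recurrence determines the entries on and above the diagonal in every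
    row but the last. *)
Lemma run_matrix_rec (i k : 'I_n) : (i < n.-1)%N -> (i <= k)%N ->
  (run_basis^T *m J *m run_basis) i k
    = al i * (i == k)%:R + be i * (i.+1 == k :> nat)%:R.
Proof.
have [orth rec _] := fin; move=> ilt ik.
rewrite run_matrixE rec // !dotl !orth //; try lia.
rewrite [X in X + _ + _](_ : _ = 0) ?add0r //.
case: (nat_of_ord i) (ltn_ord i) ik => [|m] /= mi mk; first by rewrite dot0l.
rewrite dotZl orth //; last by lia.
by rewrite (ltn_eqF (_ : m < k)%N) ?mulr0.
Qed.

End Done.

Section Result.
Variables (v : nat -> 'rV[R]_n) (al be : nat -> R).
Hypothesis fin : lanczos_done v al be.
Let T := (run_basis v)^T *m J *m run_basis v.

Lemma run_matrix_sym : T^T = T.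
Proof. by rewrite /T !trmx_mul trmxK symJ mulmxA. Qed.

Lemma run_matrix_diag i : T i i = al i.
Proof.
have [lt|ge] := ltnP i n.-1.
  rewrite (run_matrix_rec fin) // eqxx mulr1.
  by rewrite (gtn_eqF (ltnSn i)) mulr0 addr0.
have [_ _ last] := fin; rewrite run_matrixE last //.
have := ltn_ord i; lia.
Qed.

Lemma run_matrix_superdiag (i k : 'I_n) :
  k = i.+1 :> nat -> T i k = be i.
Proof.
move=> ki; have lt : (i < n.-1)%N by have := ltn_ord k; lia.
rewrite (run_matrix_rec fin) ?ki //.
rewrite -ki eqxx mulr1 -val_eqE /= ki (ltn_eqF (ltnSn i)) mulr0 add0r //.
Qed.

Lemma run_matrix_far (i k : 'I_n) : (i.+1 < k)%N -> T i k = 0.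
Proof.
move=> ik; have lt : (i < n.-1)%N by have := ltn_ord k; lia.
rewrite (run_matrix_rec fin) //; last by lia.
rewrite (ltn_eqF ik) -val_eqE /= (ltn_eqF (ltnW ik)) !mulr0 addr0 //.
Qed.

End Result.
End Lanczos.

(** * The periodic Jacobi matrix *)
Section PeriodicJacobi.
Variables (R : realType) (K : nat) (a b : 'I_K -> R) (neg : bool).
Hypothesis hK : (3 <= K)%N.
Implicit Types (i j k z : 'I_K).

Let J := Jmx a b neg.

(** The weight of the edge from i to [ordS i], the sign being absorbed into the
    edge that closes the cycle. *)
Definition cyclic_offdiag i : R :=
  if val i == K.-1 then (-1) ^+ neg * a i else a i.
Let c := cyclic_offdiag.

Lemma val_ordS i : val (ordS i) = if i.+1 == K then 0%N else i.+1.
Proof.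
rewrite /=; case: eqVneq => [->|ne]; first by rewrite modnn.
by rewrite modn_small //; have := ltn_ord i; lia.
Qed.

Lemma val_ord_pred i : val (ord_pred i) = if (0 < i)%N then i.-1 else K.-1.
Proof.
have := ltn_ord i => lti /=; case: posnP => [->|i0].
  by rewrite modn_small //; lia.
have -> : (i + K).-1 = (K + i.-1)%N by lia.
by rewrite modnDl modn_small //; lia.
Qed.

(** For K >= 3 the three cases exclude one another. *)
Lemma JmxE i j : J i j =
  if i == j then b i
  else if j == ordS i then c i else if i == ordS j then c j else 0.
Proof.
rewrite mxE; have := ltn_ord i; have := ltn_ord j => ltj lti.
rewrite -(inj_eq val_inj j) -(inj_eq val_inj i (ordS j)) !val_ordS /c.
rewrite /cyclic_offdiag /=.
case: (i == j) => //.
by do ![case: ifP; try lia].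
Qed.

Lemma Jmx_sym : J^T = J.
Proof.
apply/matrixP => i j; rewrite mxE !JmxE eq_sym; case: eqVneq => [->//|ne].
case: (eqVneq j (ordS i)) => [ji|_] //; case: eqVneq => // ij.
have := congr1 val ij; have := congr1 val ji; rewrite !val_ordS /=.
by do ![case: ifP]; lia.
Qed.

Lemma mulmx_Jmx (x : 'rV[R]_K) k : (x *m J) 0 k =
  b k * x 0 k + c k * x 0 (ordS k) + c (ord_pred k) * x 0 (ord_pred k).
Proof.
have neqS i : (ordS i == i) = false.
  rewrite -val_eqE val_ordS; have := ltn_ord i; rewrite /=; case: ifP; lia.
have neqSS i : (ordS (ordS i) == i) = false.
  rewrite -val_eqE !val_ordS; have := ltn_ord i; rewrite /=; do ![case: ifP]; lia.
rewrite mxE (bigD1 k) //= (bigD1 (ordS k)) ?neqS //=.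
rewrite (bigD1 (ord_pred k)) /=; last first.
  rewrite -{2}(ord_predK k) eq_sym neqS /= -{2}(ord_predK k) eq_sym.
  by rewrite neqSS.
rewrite big1 ?addr0; last first.
  move=> i /andP[/andP[/negbTE ik /negbTE iS] ip].
  rewrite JmxE ik iS.
  case: (eqVneq k (ordS i)) ip => [->|_ _]; last by rewrite mulr0.
  by rewrite ordSK eqxx.
have Jp : J (ord_pred k) k = c (ord_pred k).
  by rewrite JmxE ord_predK -{2}(ord_predK k) eq_sym neqS eqxx.
rewrite Jp !JmxE eqxx neqS (eq_sym k) neqSS eqxx addrA.
by rewrite !(mulrC (x _ _)).
Qed.

(** A vector of an invariant set orthogonal to the first two basis vectors
    vanishes on ever longer initial segments: if all of them vanish up to index
    m + 1, then coordinate m + 1 of x J, which is also in the set, reduces to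
    c_(m+1) x_(m+2). *)
Lemma Jmx_cyclic_pair i0 i1 : i0 = 0%N :> nat -> i1 = 1%N :> nat ->
  (forall i, c i != 0) ->
  cyclic_pair J (delta_mx 0 i0) (delta_mx 0 i1).
Proof.
move=> e0 e1 cn0 S SJ.
have S0 m : forall x k, S x -> (k <= m.+1)%N -> x 0 k = 0.
  elim: m => [|m IH] x k Sx.
    move=> km; have [_ h0 h1] := SJ x Sx.
    rewrite !dot_delta in h0 h1.
    have [k0|k1] : k = 0%N :> nat \/ k = 1%N :> nat by lia.
      by rewrite (_ : k = i0) //; apply: val_inj; rewrite /= k0 e0.
    by rewrite (_ : k = i1) //; apply: val_inj; rewrite /= k1 e1.
  rewrite leq_eqVlt => /predU1P[km|]; last exact: IH.
  have Sk : ordS (ord_pred k) = k := ord_predK k.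
  have vp : val (ord_pred k) = m.+1 by rewrite val_ord_pred km.
  have vpp : val (ord_pred (ord_pred k)) = m by rewrite val_ord_pred vp.
  have [SxJ _ _] := SJ x Sx.
  have := IH _ (ord_pred k) SxJ; rewrite mulmx_Jmx vp => /(_ (leqnn _)).
  rewrite (IH x (ord_pred k)) ?vp // (IH x (ord_pred (ord_pred k))) ?vpp //.
  rewrite !mulr0 addr0 add0r Sk => /eqP; rewrite mulf_eq0 (negbTE (cn0 _)).
  by move/eqP.
move=> x Sx; apply/rowP => k; rewrite mxE (S0 K) //.
by have := ltn_ord k; lia.
Qed.

End PeriodicJacobi.

Section Relabel.
Variables (R : realType) (K : nat) (s : 'I_K -> 'I_K) (A : 'M[R]_K).
Hypothesis s_inj : injective s.

(** The conjugating matrix is the permutation matrix of s. *)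
Lemma orthogonally_similar_relabel :
  orthogonally_similar (\matrix_(i, j) A (s i) (s j)) A.
Proof.
pose Q : 'M[R]_K := \matrix_(k, i) (k == s i)%:R.
have pick (f : 'I_K -> R) i : \sum_k (k == s i)%:R * f k = f (s i).
  rewrite (bigD1 (s i)) //= eqxx mul1r big1 ?addr0 // => k /negbTE ->.
  by rewrite mul0r.
exists Q; split; apply/matrixP => i j; rewrite !mxE.
  under eq_bigr do rewrite !mxE.
  by rewrite pick (inj_eq s_inj).
under eq_bigr => k _ do rewrite mulrC !mxE; rewrite pick.
by under eq_bigr => k _ do rewrite !mxE; rewrite pick.
Qed.

End Relabel.

(** ** Cutting the cycle at a zero weight *)
Section Cut.
Variables (R : realType) (K : nat) (a b : 'I_K -> R) (neg : bool).
Hypothesis hK : (3 <= K)%N.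
Variable z : 'I_K.
Implicit Types (i j k : 'I_K).

Let J := Jmx a b neg.
Let c := cyclic_offdiag a neg.
Hypothesis cz : c z = 0.

Definition after (m : nat) : 'I_K := iter m.+1 (@ordS K) z.

Lemma val_after m : val (after m) = ((z + m.+1) %% K)%N.
Proof.
elim: m => [|m IH]; first by rewrite /= addn1.
have -> : after m.+1 = ordS (after m) by [].
by rewrite -[val _]/((val (after m)).+1 %% K)%N IH -addn1 modnDml addn1 -addnS.
Qed.

Lemma after_inj : injective (fun i => after i).
Proof.
move=> i j /(congr1 val); rewrite !val_after => /eqP.
rewrite eqn_modDl -(addn1 i) -(addn1 j) eqn_modDr !modn_small // => /eqP.
exact: val_inj.
Qed.

Definition cut_mx : 'M[R]_K := \matrix_(i, j) J (after i) (after j).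

Lemma cut_mx_similar : orthogonally_similar cut_mx J.
Proof. exact/orthogonally_similar_relabel/after_inj. Qed.

Lemma cut_mx_sym : cut_mx^T = cut_mx.
Proof.
apply/matrixP => i j; rewrite 2![LHS]mxE [RHS]mxE.
by rewrite /J -[in LHS](Jmx_sym a b neg hK) mxE.
Qed.

Lemma cut_mx_diag i : cut_mx i i = b (after i).
Proof. by rewrite mxE /J JmxE // eqxx. Qed.

Lemma cut_mx_superdiag i j : j = i.+1 :> nat -> cut_mx i j = c (after i).
Proof.
move=> ji; have sij : after j = ordS (after i) by rewrite ji.
rewrite mxE /J JmxE // sij eqxx -sij (inj_eq after_inj) -val_eqE /=.
by rewrite ji (ltn_eqF (ltnSn i)).
Qed.

(** Two consecutive vertices of the cycle whose new numbers are not consecutive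
    are the two ends of the edge that was cut. *)
Lemma after_wrap i j : after j = ordS (after i) -> j != i.+1 :> nat -> after i = z.
Proof.
move=> e ne; have lti := ltn_ord i; have ltj := ltn_ord j.
have iK : i.+1 = K.
  have := congr1 val e; rewrite -[ordS _]/(after i.+1) !val_after => /eqP.
  rewrite eqn_modDl -(addn1 j) -(addn1 i.+1) eqn_modDr (modn_small ltj) => h.
  have [//|lt] : i.+1 = K \/ (i.+1 < K)%N by lia.
  by move: h ne; rewrite (modn_small lt) eq_sym => ->.
by apply: val_inj; rewrite val_after iK modnDr modn_small.
Qed.

Lemma cut_mx_tridiagonal : tridiagonal cut_mx.
Proof.
move=> i j far; have ij : i.+1 != j :> nat by lia.
have ji : j.+1 != i :> nat by lia.
have ne : (after i == after j) = false.
  by rewrite (inj_eq after_inj); apply/negbTE/eqP => e; move: far; rewrite e; lia.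
rewrite mxE /J JmxE // ne.
case: eqVneq => [/after_wrap h|_].
  by rewrite h ?cz // eq_sym.
case: eqVneq => [/after_wrap h|//].
by rewrite h ?cz // eq_sym.
Qed.

End Cut.

(** * Execution within resource bounds *)

Local Open Scope fmap_scope.

(** Two arrays of data, two of results, three vectors and the residual, and
    nine scalars, each stored in cell 0 of an array of its own. *)
Definition num_arrays : nat := 17.
Definition num_vars : nat := 6.

(** Runs the variable i from 0 to K - 1; the order K is in variable 0. *)
Definition for_loop (i : nat) (c : cmd) : cmd :=
  Seq (Do (ISet i (IConst 0)))
      (While (ILt (IVar i) (IVar 0))
             (Seq c (Do (ISet i (IAdd (IVar i) (IConst 1)))))).

Section Execution.
Variables (R : realType) (M : nat).
Implicit Types (s : state R) (c : cmd) (Q : state R -> Prop) (N : nat).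

(** A total-correctness triple: a postcondition together with a bound N on the
    number of operations, all states fitting in M. *)
Definition within c N s Q := exists n s', [/\ (n <= N)%N, exec M c s n s' & Q s'].

Lemma within_weaken c N N' s Q Q' :
  (N <= N')%N -> (forall s, Q s -> Q' s) -> within c N s Q -> within c N' s Q'.
Proof.
move=> NN QQ [n [s' [nN e q]]]; exists n, s'; split=> //; last exact: QQ.
exact: leq_trans NN.
Qed.

Lemma within_skip s Q : Q s -> within Skip 0 s Q.
Proof. by move=> q; exists 0%N, s; split=> //; constructor. Qed.

Lemma within_do (c : instr) s s' Q :
  instr_eval c s = Some s' -> fits M s' -> Q s' -> within (Do c) 1 s Q.
Proof. by move=> e f q; exists 1%N, s'; split=> //; constructor. Qed.

Lemma within_seq c1 c2 N1 N2 s Q :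
  within c1 N1 s (fun s' => within c2 N2 s' Q) ->
  within (Seq c1 c2) (N1 + N2) s Q.
Proof.
move=> [n1 [s1 [nN1 e1 [n2 [s2 [nN2 e2 q]]]]]].
exists (n1 + n2)%N, s2; split=> //; first exact: leq_add.
exact: ExecSeq e1 e2.
Qed.

Lemma within_if t c1 c2 v N s Q : test_eval t s = Some v ->
  within (if v then c1 else c2) N s Q -> within (If t c1 c2) N.+1 s Q.
Proof.
move=> tv [n [s1 [nN e q]]]; exists n.+1, s1; split=> //.
exact: ExecIf tv e.
Qed.

(** The K + 1 tests and K rounds cost K (N + 1) + 1 operations, the
    initialization of the variable one more. *)
Lemma within_for i c N K (Inv : nat -> state R -> Prop) s :
  let s0 := State (rmem s) (imem s).[i <- 0%N] in
  fits M s0 -> Inv 0%N s0 ->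
  (forall k s, (k <= K)%N -> Inv k s ->
     (imem s).[? 0%N] = Some K /\ (imem s).[? i] = Some k) ->
  (forall k s, (k < K)%N -> Inv k s ->
     within (Seq c (Do (ISet i (IAdd (IVar i) (IConst 1))))) N s (Inv k.+1)) ->
  within (for_loop i c) (K * N.+1 + 2) s (Inv K).
Proof.
move=> s0 f0 I0 look step.
rewrite /for_loop; set W := While _ _.
suff H m : forall k s, (k + m)%N = K -> Inv k s -> within W (m * N.+1).+1 s (Inv K).
  have [n [s1 [nN e q]]] := H K 0%N s0 (add0n K) I0.
  exists (1 + n)%N, s1; split=> //; first by lia.
  by apply: ExecSeq e; apply: ExecDo.
elim: m => [|m IH] k s1 km Ik.
  rewrite addn0 in km; rewrite km in Ik.
  have [h0 hi] := look _ _ (leqnn K) Ik.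
  exists 1%N, s1; split=> //; apply: ExecWhileStop.
  by rewrite /= h0 hi ltnn.
have kK : (k < K)%N by lia.
have [h0 hi] := look _ _ (ltnW kK) Ik.
have [n1 [s2 [nN1 e1 I2]]] := step _ _ kK Ik.
have [|n2 [s3 [nN2 e2 I3]]] := IH k.+1 s2 _ I2; first by lia.
exists (n1 + n2).+1, s3; split=> //; first by rewrite mulSn; lia.
by apply: ExecWhileLoop e1 e2; rewrite /= h0 hi kK.
Qed.

End Execution.

Record view (R : Type) := View {
  cell : nat -> nat -> R;
  idx : nat -> nat
}.

Section Views.
Variables (R : realType) (K : nat).
Hypothesis hK : (0 < K)%N.
Implicit Types (s : state R) (v : view R) (c : cmd) (x : loc) (e : iexp) (b : test).

Let M := ((num_arrays + num_vars) * K)%N.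

(** All cells in range are defined: evaluation in a represented state can only
    fail on an address out of range, a zero divisor or a negative radicand.
    Variable 0 holds K throughout; [instr_ok] forbids assigning to it. *)
Record represents s v : Prop := Represents {
  rep_cell : forall t k, (rmem s).[? (t, k)] =
    if (t < num_arrays)%N && (k < K)%N then Some (cell v t k) else None;
  rep_idx : forall i, (imem s).[? i] =
    if (i < num_vars)%N then Some (idx v i) else None;
  rep_le : forall i, (idx v i <= K)%N;
  rep_order : idx v 0 = K }.

Lemma cardfs_le_size (T : choiceType) (A : {fset T}) (l : seq T) :
  {subset A <= l} -> (#|` A| <= size l)%N.
Proof. by move=> Al; apply: uniq_leq_size. Qed.

(** The cells in use form a subset of a rectangle of size num_arrays * K. *)
Lemma fits_bounded s :
  (forall t k, (t, k) \in domf (rmem s) -> (t < num_arrays)%N && (k < K)%N) ->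
  (forall i, i \in domf (imem s) -> (i < num_vars)%N) ->
  (forall i n, (imem s).[? i] = Some n -> (n <= K)%N) ->
  fits M s.
Proof.
move=> hr hi hv; split; last first.
  by move=> i n /hv; rewrite /M /num_arrays /num_vars; lia.
have r : (#|` domf (rmem s)| <= num_arrays * K)%N.
  pose l := [seq (t, k) | t <- iota 0 num_arrays, k <- iota 0 K].
  apply: (@leq_trans (size l)); last by rewrite size_allpairs !size_iota.
  apply: cardfs_le_size => -[t k] /hr /andP[tN kK].
  by apply: allpairs_f; rewrite mem_iota.
have i : (#|` domf (imem s)| <= num_vars)%N.
  rewrite -[leqRHS](size_iota 0); apply: cardfs_le_size => i /hi iN.
  by rewrite mem_iota.
rewrite /storage /M; move: r i; rewrite /num_arrays /num_vars; lia.
Qed.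

Lemma represents_fits s v : represents s v -> fits M s.
Proof.
move=> [hc hi hl h0]; apply: fits_bounded.
- move=> t k; rewrite -fndSome hc; by case: ifP.
- move=> i; rewrite -fndSome hi; by case: ifP.
- by move=> i n; rewrite hi; case: ifP => // _ [<-].
Qed.

Definition set_cell (f : nat -> nat -> R) (a k : nat) (u : R) : nat -> nat -> R :=
  fun a' k' => if (a' == a) && (k' == k) then u else f a' k'.

Definition set_idx (g : nat -> nat) (i n : nat) : nat -> nat :=
  fun i' => if i' == i then n else g i'.

Fixpoint value v e : nat :=
  match e with
  | IConst n => n
  | IVar i => idx v i
  | IAdd e1 e2 => (value v e1 + value v e2)%N
  | ISub e1 e2 => (value v e1 - value v e2)%N
  end.

Fixpoint vars_ok e : bool :=
  match e with
  | IConst n => true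
  | IVar i => (i < num_vars)%N
  | IAdd e1 e2 | ISub e1 e2 => vars_ok e1 && vars_ok e2
  end.

Definition fetch v x : R := let: Cell a e := x in cell v a (value v e).

Definition store v x (u : R) : view R :=
  let: Cell a e := x in View (set_cell (cell v) a (value v e) u) (idx v).

Definition loc_ok v x : bool :=
  let: Cell a e := x in [&& (a < num_arrays)%N, vars_ok e & (value v e < K)%N].

Definition rop_value o (u w : R) : R :=
  match o with
  | Defs.Add => u + w | Defs.Sub => u - w | Defs.Mul => u * w
  | Defs.Div => u / w
  end.

Definition effect (i : instr) v : view R :=
  match i with
  | RConst x n => store v x n%:R
  | RMove x y => store v x (fetch v y)
  | ROp o x y z => store v x (rop_value o (fetch v y) (fetch v z))
  | RSqrt x y => store v x (Num.sqrt (fetch v y))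
  | ISet j e => View (cell v) (set_idx (idx v) j (value v e))
  end.

(** The conditions under which the partial semantics of an instruction is
    defined and keeps the indices at most K. *)
Definition instr_ok (i : instr) v : Prop :=
  match i with
  | RConst x n => loc_ok v x
  | RMove x y => loc_ok v x /\ loc_ok v y
  | ROp o x y z => [/\ loc_ok v x, loc_ok v y, loc_ok v z &
                       if o is Defs.Div then fetch v z != 0 else true]
  | RSqrt x y => [/\ loc_ok v x, loc_ok v y & 0 <= fetch v y]
  | ISet j e => [/\ (0 < j < num_vars)%N, vars_ok e & (value v e <= K)%N]
  end.

Definition outcome b v : bool :=
  match b with
  | RLt x y => fetch v x < fetch v y
  | REq x y => fetch v x == fetch v y
  | ILt e1 e2 => (value v e1 < value v e2)%N
  | IEq e1 e2 => value v e1 == value v e2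
  end.

Definition test_ok b v : bool :=
  match b with
  | RLt x y | REq x y => loc_ok v x && loc_ok v y
  | ILt e1 e2 | IEq e1 e2 => vars_ok e1 && vars_ok e2
  end.

Lemma ieval_value s v e : represents s v -> vars_ok e ->
  ieval s e = Some (value v e).
Proof.
move=> rep; elim: e => [n|i|e1 IH1 e2 IH2|e1 IH1 e2 IH2] //=.
- by move=> h; rewrite (rep_idx rep) h.
- by case/andP => /IH1 -> /IH2 ->.
- by case/andP => /IH1 -> /IH2 ->.
Qed.

Lemma rread_fetch s v x : represents s v -> loc_ok v x ->
  rread s x = Some (fetch v x).
Proof.
move=> rep; case: x => a e /= /and3P[ha he hv].
by rewrite /rread /= (ieval_value rep he) (rep_cell rep) ha hv.
Qed.

Lemma rwrite_store s v x u : represents s v -> loc_ok v x ->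
  exists2 s', rwrite s x u = Some s' & represents s' (store v x u).
Proof.
move=> rep; case: x => a e /= /and3P[ha he hv].
rewrite /rwrite /= (ieval_value rep he); eexists; first by [].
split=> /=; [|exact: rep_idx rep|exact: rep_le rep|exact: rep_order rep].
move=> a' k; rewrite fnd_set /set_cell xpair_eqE (rep_cell rep).
by case: eqVneq => [->|_] //=; case: eqVneq => [->|_] //=; rewrite ha hv.
Qed.

Lemma instr_effect s v i : represents s v -> instr_ok i v ->
  exists2 s', instr_eval i s = Some s' & represents s' (effect i v).
Proof.
move=> rep; case: i => [x n|x y|o x y z|x y|j e] /=.
- exact: rwrite_store.
- move=> [hx hy]; rewrite (rread_fetch rep hy); exact: rwrite_store.
- move=> [hx hy hz ho]; rewrite (rread_fetch rep hy) (rread_fetch rep hz).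
  rewrite (_ : rop_eval o _ _ = Some (rop_value o (fetch v y) (fetch v z))).
    exact: rwrite_store.
  by case: o ho => //= /negbTE ->.
- move=> [hx hy h0]; rewrite (rread_fetch rep hy) /sqrt_eval ltNge h0.
  exact: rwrite_store.
- move=> [/andP[j0 hj] he hv]; rewrite (ieval_value rep he); eexists; first by [].
  split=> /=; [exact: rep_cell rep| | |].
  + move=> i; rewrite fnd_set (rep_idx rep) /set_idx.
    by case: eqVneq => [->|_] //; rewrite hj.
  + by move=> i; rewrite /set_idx; case: ifP => // _; exact: rep_le rep i.
  + by rewrite /set_idx (ltn_eqF j0) (rep_order rep).
Qed.

Lemma test_outcome s v b : represents s v -> test_ok b v ->
  test_eval b s = Some (outcome b v).
Proof.
move=> rep; case: b => [x y|x y|e1 e2|e1 e2] /= /andP[h1 h2];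
  by rewrite ?(rread_fetch rep h1) ?(rread_fetch rep h2)
             ?(ieval_value rep h1) ?(ieval_value rep h2).
Qed.

(** The effect of loop-free commands as a function that computes, so that whole
    loop bodies are executed by simplification; [safe] rejects loops, whose
    value here is a dummy. *)
Fixpoint denote c v : view R :=
  match c with
  | Skip | While _ _ => v
  | Do i => effect i v
  | Seq c1 c2 => denote c2 (denote c1 v)
  | If t c1 c2 => if outcome t v then denote c1 v else denote c2 v
  end.

Fixpoint safe c v : Prop :=
  match c with
  | Skip => True
  | While _ _ => False
  | Do i => instr_ok i v
  | Seq c1 c2 => safe c1 v /\ safe c2 (denote c1 v)
  | If t c1 c2 => test_ok t v /\ if outcome t v then safe c1 v else safe c2 v
  end.

Fixpoint cost c : nat :=
  match c with
  | Skip | While _ _ => 0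
  | Do i => 1
  | Seq c1 c2 => cost c1 + cost c2
  | If t c1 c2 => (maxn (cost c1) (cost c2)).+1
  end.

(** The judgement [within] read through views: proofs about programs only deal
    with total functions. *)
Definition reaches c N v (Q : view R -> Prop) :=
  forall s, represents s v ->
    within M c N s (fun s' => exists2 v', represents s' v' & Q v').

Lemma reaches_weaken c N N' v Q Q' :
  (N <= N')%N -> (forall v', Q v' -> Q' v') -> reaches c N v Q -> reaches c N' v Q'.
Proof.
move=> NN QQ h s rep; apply: within_weaken NN _ (h s rep) => s' [v' r' q'].
by exists v' => //; exact: QQ.
Qed.

Lemma reaches_order c N v Q :
  (idx v 0 = K -> reaches c N v Q) -> reaches c N v Q.
Proof. by move=> h s rep; apply: h (rep_order rep) _ rep. Qed.

Lemma reaches_seq c1 c2 N1 N2 v Q Q' :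
  reaches c1 N1 v Q -> (forall v', Q v' -> reaches c2 N2 v' Q') ->
  reaches (Seq c1 c2) (N1 + N2) v Q'.
Proof.
move=> h1 h2 s rep; apply: within_seq.
apply: within_weaken (leqnn _) _ (h1 s rep) => s' [v' r' q'].
exact: h2 q' _ r'.
Qed.

Lemma reaches_if b c1 c2 N v Q : test_ok b v ->
  (if outcome b v then reaches c1 N v Q else reaches c2 N v Q) ->
  reaches (If b c1 c2) N.+1 v Q.
Proof.
move=> ok h s rep; apply: within_if (test_outcome rep ok) _.
by move: h; case: ifP => _; apply.
Qed.

Lemma reaches_denote c v Q : safe c v -> Q (denote c v) -> reaches c (cost c) v Q.
Proof.
elim: c v Q => [|i|c1 IH1 c2 IH2|t c1 IH1 c2 IH2|t c IH] v Q //=.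
- by move=> _ q s rep; apply: within_skip; exists v.
- move=> ok q s rep; have [s' e rep'] := instr_effect rep ok.
  apply: within_do e _ _; first exact: represents_fits rep'.
  by exists (effect i v).
- move=> [s1 s2] q.
  apply: reaches_seq (IH1 _ (fun v' => v' = denote c1 v) s1 _) _ => //.
  by move=> _ ->; apply: IH2.
- move=> [ok h] q; apply: reaches_if ok _.
  case: ifP h q => _ h q.
    by apply: reaches_weaken (IH1 _ _ h q) => //; exact: leq_maxl.
  by apply: reaches_weaken (IH2 _ _ h q) => //; exact: leq_maxr.
Qed.

(** Two operations per round are added to those of the body, for the test and
    for the increment, which the invariant has to survive. *)
Lemma reaches_for i c N (Inv : nat -> view R -> Prop) v :
  (0 < i < num_vars)%N ->
  (Inv 0%N (View (cell v) (set_idx (idx v) i 0))) ->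
  (forall k v, (k < K)%N -> idx v 0 = K -> idx v i = k -> Inv k v ->
     reaches c N v (fun v' => idx v' i = k /\
        Inv k.+1 (View (cell v') (set_idx (idx v') i k.+1)))) ->
  reaches (for_loop i c) (K * N.+2 + 2) v (fun v' => idx v' i = K /\ Inv K v').
Proof.
move=> hi I0 step s rep.
pose Inv' k s' := exists2 v', represents s' v' & idx v' i = k /\ Inv k v'.
have [i0 iN] := andP hi.
have ok0 : instr_ok (ISet i (IConst 0)) v by [].
have [s0 [s0E] rep0] := instr_effect rep ok0.
rewrite -/(Inv' K); apply: within_for.
- rewrite s0E; exact: represents_fits rep0.
- exists (View (cell v) (set_idx (idx v) i 0)); first by rewrite s0E.
  by split=> //; rewrite /= /set_idx eqxx.
- move=> k s1 kK [v1 rep1 [hk _]]; rewrite !(rep_idx rep1) iN /=.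
  by rewrite hk (rep_order rep1).
- move=> k s1 kK [v1 rep1 [hk Ik]]; rewrite -[N.+1]addn1; apply: within_seq.
  have h := step k v1 kK (rep_order rep1) hk Ik s1 rep1.
  apply: within_weaken (leqnn _) _ h => s2 [v2 rep2 [h2 I2]].
  have ok2 : instr_ok (ISet i (IAdd (IVar i) (IConst 1))) v2.
    by split; rewrite /= ?hi ?iN ?h2 ?addn1.
  have [s3 e3 rep3] := instr_effect rep2 ok2.
  apply: within_do e3 _ _; first exact: represents_fits rep3.
  eexists; first exact: rep3.
  by rewrite /= h2 addn1; split=> //; rewrite /set_idx eqxx.
Qed.

End Views.

(** * The program *)

(** Arrays: the data, with [offJ] holding the weights of the cycle once the
    sign is absorbed, the two diagonals of the result, the current and previous
    Lanczos vectors, the orthogonal part of e_1, the residual, then scalars. *)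
Local Notation offJ := 0%N (only parsing).
Local Notation diagJ := 1%N (only parsing).
Local Notation diagT := 2%N (only parsing).
Local Notation offT := 3%N (only parsing).
Local Notation cur := 4%N (only parsing).
Local Notation prv := 5%N (only parsing).
Local Notation rest := 6%N (only parsing).
Local Notation new := 7%N (only parsing).
Local Notation alpha := 8%N (only parsing).
Local Notation rho := 9%N (only parsing).
Local Notation newsq := 10%N (only parsing).
Local Notation remsq := 11%N (only parsing).
Local Notation tmp1 := 12%N (only parsing).
Local Notation tmp2 := 13%N (only parsing).
Local Notation beta := 14%N (only parsing).
Local Notation len := 15%N (only parsing).
Local Notation zero := 16%N (only parsing).

(** Index variables; [ixnext] and [ixprev] hold the cyclic neighbours of an
    index. *)
Local Notation ixorder := 0%N (only parsing).
Local Notation ixsign := 1%N (only parsing).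
Local Notation ixouter := 2%N (only parsing).
Local Notation ixinner := 3%N (only parsing).
Local Notation ixnext := 4%N (only parsing).
Local Notation ixprev := 5%N (only parsing).

Definition at_var (t i : nat) : loc := Cell t (IVar i).
Definition scalar (t : nat) : loc := Cell t (IConst 0).
Definition last_cell (t : nat) : loc := Cell t (ISub (IVar ixorder) (IConst 1)).

Definition seqs : seq cmd -> cmd := foldr Seq Skip.

Definition op3 o x y z : cmd := Do (ROp o x y z).

Definition set_succ (i j : nat) : cmd :=
  If (ILt (IAdd (IVar j) (IConst 1)) (IVar ixorder))
     (Do (ISet i (IAdd (IVar j) (IConst 1))))
     (Do (ISet i (IConst 0))).

Definition set_pred (i j : nat) : cmd :=
  If (ILt (IConst 0) (IVar j))
     (Do (ISet i (ISub (IVar j) (IConst 1))))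
     (Do (ISet i (ISub (IVar ixorder) (IConst 1)))).

Definition add_product acc x y : seq cmd :=
  [:: op3 Defs.Mul (scalar tmp2) x y;
      op3 Defs.Add (scalar acc) (scalar acc) (scalar tmp2)].

Definition sub_product x c y : seq cmd :=
  [:: op3 Defs.Mul (scalar tmp2) c y; op3 Defs.Sub x x (scalar tmp2)].

(** Entry k of q J - beta p, and the contributions of k to its product with q
    and to the product of r with q. *)
Definition residual_body : cmd := seqs (
  [:: set_succ ixnext ixinner; set_pred ixprev ixinner;
     op3 Defs.Mul (scalar tmp1) (at_var diagJ ixinner) (at_var cur ixinner)] ++
  add_product tmp1 (at_var offJ ixinner) (at_var cur ixnext) ++
  add_product tmp1 (at_var offJ ixprev) (at_var cur ixprev) ++
  [:: Do (RMove (at_var new ixinner) (scalar tmp1))] ++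
  sub_product (at_var new ixinner) (scalar beta) (at_var prv ixinner) ++
  add_product alpha (at_var new ixinner) (at_var cur ixinner) ++
  add_product rho (at_var rest ixinner) (at_var cur ixinner)).

(** Removes from the residual and from r their components along q, and sums up
    the squares of the entries. *)
Definition project_body : cmd := seqs (
  sub_product (at_var new ixinner) (scalar alpha) (at_var cur ixinner) ++
  sub_product (at_var rest ixinner) (scalar rho) (at_var cur ixinner) ++
  add_product newsq (at_var new ixinner) (at_var new ixinner) ++
  add_product remsq (at_var rest ixinner) (at_var rest ixinner)).

(** The squared norm of the residual is zero exactly at a breakdown. *)
Definition advance_body : cmd :=
  Seq (Do (RMove (at_var prv ixinner) (at_var cur ixinner)))
      (If (REq (scalar newsq) (scalar zero))
          (op3 Defs.Div (at_var cur ixinner) (at_var rest ixinner) (scalar len))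
          (op3 Defs.Div (at_var cur ixinner) (at_var new ixinner) (scalar len))).

Definition find_zero_body : cmd :=
  If (REq (at_var offJ ixinner) (scalar zero))
     (Do (ISet ixouter (IVar ixinner))) Skip.

(** The neighbour is advanced before it is read: started at a zero weight z,
    the copy begins with index z + 1. *)
Definition cut_body : cmd := seqs
  [:: set_succ ixnext ixnext;
     Do (RMove (at_var diagT ixinner) (at_var diagJ ixnext));
     Do (RMove (at_var offT ixinner) (at_var offJ ixnext))].

Definition clear_row (l : seq nat) : cmd :=
  seqs [seq Do (RConst (at_var t ixinner) 0) | t <- l].

(** Every array except the two that hold the input. *)
Definition work_arrays : seq nat := iota 2 15.

Definition init : cmd := seqs
  [:: Do (ISet ixouter (IConst 0)); Do (ISet ixinner (IConst 0));
      Do (ISet ixnext (IConst 0)); Do (ISet ixprev (IConst 0));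
      for_loop ixinner (clear_row work_arrays)].

Definition fix_sign : cmd :=
  If (IEq (IVar ixsign) (IConst 1))
     (op3 Defs.Sub (last_cell offJ) (scalar zero) (last_cell offJ)) Skip.

(** Leaves in [ixouter] the position of a zero weight, or K if there is none. *)
Definition find_zero : cmd :=
  Seq (Do (ISet ixouter (IVar ixorder))) (for_loop ixinner find_zero_body).

Definition cut : cmd :=
  Seq (Do (ISet ixnext (IVar ixouter))) (for_loop ixinner cut_body).

Definition clear_sums : cmd := seqs
  [:: Do (RConst (scalar alpha) 0); Do (RConst (scalar rho) 0);
      Do (RConst (scalar newsq) 0); Do (RConst (scalar remsq) 0)].

Definition orthogonalize : cmd := seqs
  [:: clear_sums; for_loop ixinner residual_body; for_loop ixinner project_body].

Definition choose_length : cmd := seqs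
  [:: If (REq (scalar newsq) (scalar zero))
        (seqs [:: Do (RConst (scalar beta) 0);
                  Do (RSqrt (scalar len) (scalar remsq))])
        (seqs [:: Do (RSqrt (scalar beta) (scalar newsq));
                  Do (RMove (scalar len) (scalar beta))]);
      Do (RMove (at_var offT ixouter) (scalar beta))].

Definition lanczos_body : cmd := seqs
  [:: orthogonalize; Do (RMove (at_var diagT ixouter) (scalar alpha));
      If (ILt (IAdd (IVar ixouter) (IConst 1)) (IVar ixorder))
         (Seq choose_length (for_loop ixinner advance_body)) Skip].

Definition lanczos : cmd := seqs
  [:: Do (RConst (scalar cur) 1); Do (RConst (Cell rest (IConst 1)) 1);
      for_loop ixouter lanczos_body].

Definition tridiagonalize : cmd := seqs
  [:: init; fix_sign; find_zero;
      If (ILt (IVar ixouter) (IVar ixorder)) cut lanczos].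

(** * The loops over one vector *)

Section Loops.
Variables (R : realType) (K : nat).
Hypothesis hK : (3 <= K)%N.
Implicit Types (v : view R).

Let K_gt0 : (0 < K)%N. Proof. by apply: leq_trans hK. Qed.

(** The arrays, resp. variables, that may differ are listed. *)
Definition same_cells (l : seq nat) v v' :=
  forall t k, t \notin l -> cell v' t k = cell v t k.
Definition same_idx (l : seq nat) v v' :=
  forall i, i \notin l -> idx v' i = idx v i.

Lemma notin_sub (t : nat) (l l' : seq nat) :
  t \notin l' -> all (mem l') l -> t \notin l.
Proof. by move=> tl /allP sub; apply: contra tl; exact: sub. Qed.

Definition nextn k : nat := if (k.+1 < K)%N then k.+1 else 0%N.
Definition prevn k : nat := if (0 < k)%N then k.-1 else K.-1.

Lemma reaches_set_succ i j v : (0 < i < num_vars)%N -> (j < num_vars)%N ->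
  idx v 0 = K -> (idx v j < K)%N ->
  reaches K (set_succ i j) 2 v
    (fun v' => v' = View (cell v) (set_idx (idx v) i (nextn (idx v j)))).
Proof.
move=> hi hj h0 hjK; apply: (reaches_denote K_gt0).
  by rewrite /= hj h0 addn1; split=> //; case: ifP.
by rewrite /= h0 addn1 /nextn; case: ifP.
Qed.

Lemma reaches_set_pred i j v : (0 < i < num_vars)%N -> (j < num_vars)%N ->
  idx v 0 = K -> (idx v j < K)%N ->
  reaches K (set_pred i j) 2 v
    (fun v' => v' = View (cell v) (set_idx (idx v) i (prevn (idx v j)))).
Proof.
move=> hi hj h0 hjK; apply: (reaches_denote K_gt0).
  by rewrite /= hj h0; split=> //; case: ifP => _; split=> //=; rewrite ?hj //; lia.
by rewrite /= h0 !subn1 /prevn; case: ifP.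
Qed.

Lemma nextn_lt k : (nextn k < K)%N.
Proof. by rewrite /nextn; case: ifP. Qed.

Lemma prevn_lt k : (k < K)%N -> (prevn k < K)%N.
Proof. by rewrite /prevn; case: ifP; lia. Qed.

Definition residual_entry v k : R :=
  cell v diagJ k * cell v cur k + cell v offJ k * cell v cur (nextn k)
  + cell v offJ (prevn k) * cell v cur (prevn k)
  - cell v beta 0 * cell v prv k.

(** The two neighbours are computed first; the rest of the body is then
    evaluated symbolically with these indices as unknowns. *)
Lemma residual_loop v : cell v alpha 0 = 0 -> cell v rho 0 = 0 ->
  reaches K (for_loop ixinner residual_body) (K * 18 + 2) v (fun v' =>
   [/\ same_cells [:: new; alpha; rho; tmp1; tmp2] v v',
       same_idx [:: ixinner; ixnext; ixprev] v v',
       forall k, (k < K)%N -> cell v' new k = residual_entry v k,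
       cell v' alpha 0 = \sum_(0 <= k < K) residual_entry v k * cell v cur k &
       cell v' rho 0 = \sum_(0 <= k < K) cell v rest k * cell v cur k]).
Proof.
move=> a0 r0.
pose Inv n v' :=
   [/\ same_cells [:: new; alpha; rho; tmp1; tmp2] v v',
       same_idx [:: ixinner; ixnext; ixprev] v v',
       forall k, (k < n)%N -> cell v' new k = residual_entry v k,
       cell v' alpha 0 = \sum_(0 <= k < n) residual_entry v k * cell v cur k &
       cell v' rho 0 = \sum_(0 <= k < n) cell v rest k * cell v cur k].
(* The body takes 16 operations, 2 for each neighbour and 12 for the rest. *)
have H := @reaches_for R K K_gt0 ixinner residual_body 16 Inv v.
apply: reaches_weaken (H _ _ _).
- by [].
- by move=> v' [].
- by [].
- split=> //=.
  + move=> i; rewrite /set_idx /= !inE; by case: eqP.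
  + by rewrite big_nil.
  + by rewrite big_nil.
move=> k [f g] kK /= h0 hk [/= hc hi hn ha hr].
apply: (@reaches_seq _ _ _ _ 2 14).
  by apply: reaches_set_succ; rewrite //= hk.
move=> _ ->; apply: (@reaches_seq _ _ _ _ 2 12).
  by apply: reaches_set_pred; rewrite /= /set_idx /= ?hk.
move=> _ ->.
set g' := set_idx _ 5 _.
have g0 : g' 0%N = K by exact: h0.
have g3 : g' 3%N = k by exact: hk.
have g4 : g' 4%N = nextn k by rewrite -hk.
have g5 : g' 5%N = prevn k by rewrite /g' /set_idx /= hk.
have gE i : i \notin [:: ixinner; ixnext; ixprev] -> g' i = idx v i.
  move=> ni; rewrite -(hi _ ni) /g' /= /set_idx /=.
  by move: ni; rewrite !inE !negb_or => /and3P[_ /negbTE -> /negbTE ->].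
clearbody g'.
have lt4 := nextn_lt k.
have lt5 := prevn_lt kK.
apply: (reaches_denote K_gt0).
  rewrite /= g3 g4 g5 kK lt4 lt5 K_gt0. 
  do ![split=> //].
rewrite /= /set_cell /= g3 g4 g5 !eqxx /=.
have fE t i : t \notin [:: new; alpha; rho; tmp1; tmp2] -> f t i = cell v t i
  by apply: hc.
rewrite !(fE offJ, fE diagJ, fE cur, fE prv, fE rest, fE beta) //.
rewrite -/(residual_entry v k); split=> //; split=> /=.
- move=> t i ht; rewrite -(fE _ _ ht) /=; move: ht; rewrite !inE !negb_or.
  by case/and5P => /negbTE-> /negbTE-> /negbTE-> /negbTE-> /negbTE->.
- move=> i ni; rewrite /= /set_idx; have := ni; rewrite !inE !negb_or.
  by case/and3P => /negbTE -> _ _; exact: gE.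
- by move=> i; rewrite ltnS leq_eqVlt; case: eqVneq => [->|_] //=; exact: hn.
- by rewrite big_nat_recr //= -ha.
- by rewrite big_nat_recr //= -hr.
Qed.

Definition new_entry v k : R := cell v new k - cell v alpha 0 * cell v cur k.
Definition rem_entry v k : R := cell v rest k - cell v rho 0 * cell v cur k.

Lemma project_loop v : cell v newsq 0 = 0 -> cell v remsq 0 = 0 ->
  reaches K (for_loop ixinner project_body) (K * 10 + 2) v (fun v' =>
   [/\ same_cells [:: rest; new; newsq; remsq; tmp2] v v',
       same_idx [:: ixinner] v v',
       forall k, (k < K)%N ->
         cell v' new k = new_entry v k /\ cell v' rest k = rem_entry v k,
       cell v' newsq 0 = \sum_(0 <= k < K) new_entry v k * new_entry v k &
       cell v' remsq 0 = \sum_(0 <= k < K) rem_entry v k * rem_entry v k]).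
Proof.
move=> n0 r0.
pose Inv n v' :=
   [/\ same_cells [:: rest; new; newsq; remsq; tmp2] v v',
       same_idx [:: ixinner] v v',
       forall k, if (k < n)%N
         then cell v' new k = new_entry v k /\ cell v' rest k = rem_entry v k
         else cell v' new k = cell v new k /\ cell v' rest k = cell v rest k,
       cell v' newsq 0 = \sum_(0 <= k < n) new_entry v k * new_entry v k &
       cell v' remsq 0 = \sum_(0 <= k < n) rem_entry v k * rem_entry v k].
have H := @reaches_for R K K_gt0 ixinner project_body 8 Inv v.
apply: reaches_weaken (H _ _ _).
- by [].
- by move=> v' [_ [hc hi hn h1 h2]]; split=> // k kK; have := hn k; rewrite kK.
- by [].
- split=> //=.
  + by move=> i; rewrite /set_idx /= !inE => /negbTE ->.
  + by rewrite big_nil.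
  + by rewrite big_nil.
move=> k [f g] kK /= h0 hk [/= hc hi hn h1 h2].
apply: (reaches_denote K_gt0).
  by rewrite /= hk kK K_gt0; do ![split=> //].
have fE t i : t \notin [:: rest; new; newsq; remsq; tmp2] -> f t i = cell v t i
  by apply: hc.
have := hn k; rewrite ltnn => -[nk rk].
rewrite /= /set_cell /= hk !eqxx /= nk rk.
rewrite !(fE cur, fE alpha, fE rho) // -/(new_entry v k) -/(rem_entry v k).
split=> //; split=> /=.
- move=> t i ht; rewrite -(fE _ _ ht) /=; move: ht; rewrite !inE !negb_or.
  by case/and5P => /negbTE-> /negbTE-> /negbTE-> /negbTE-> /negbTE->.
- move=> i ni; rewrite /set_idx -(hi _ ni) /=.
  by move: ni; rewrite inE => /negbTE ->.
- by move=> i; rewrite ltnS leq_eqVlt; have := hn i; case: (eqVneq i k) => [->|_] /=.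
- by rewrite big_nat_recr //= -h1.
- by rewrite big_nat_recr //= -h2.
Qed.

Lemma advance_loop v : cell v len 0 != 0 ->
  reaches K (for_loop ixinner advance_body) (K * 5 + 2) v (fun v' =>
   [/\ same_cells [:: cur; prv] v v', same_idx [:: ixinner] v v' &
       forall k, (k < K)%N -> cell v' prv k = cell v cur k /\
         cell v' cur k = (if cell v newsq 0 == cell v zero 0 then cell v rest k
                          else cell v new k) / cell v len 0]).
Proof.
move=> l0.
pose Inv n v' :=
   [/\ same_cells [:: cur; prv] v v', same_idx [:: ixinner] v v' &
       forall k, if (k < n)%N then cell v' prv k = cell v cur k /\
         cell v' cur k = (if cell v newsq 0 == cell v zero 0 then cell v rest k
                          else cell v new k) / cell v len 0
         else cell v' cur k = cell v cur k].
have H := @reaches_for R K K_gt0 ixinner advance_body 3 Inv v.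
apply: reaches_weaken (H _ _ _).
- by [].
- by move=> v' [_ [hc hi hn]]; split=> // k kK; have := hn k; rewrite kK.
- by [].
- by split=> //= i; rewrite /set_idx /= !inE => /negbTE ->.
move=> k [f g] kK /= h0 hk [/= hc hi hn].
have fE t i : t \notin [:: cur; prv] -> f t i = cell v t i by apply: hc.
have := hn k; rewrite ltnn => ck.
apply: (reaches_denote K_gt0).
  rewrite /= /set_cell /= hk kK K_gt0 (fE len) //.
  by do ![split=> //]; case: ifP; split.
rewrite /= /set_cell /= !(fE newsq, fE zero) //.
pose val :=
  (if cell v newsq 0 == cell v zero 0 then f rest k else f new k) / f len 0%N.
set w := if _ then _ else _.
have -> : w = View (set_cell (set_cell f prv k (f cur k)) cur k val) g.
  by rewrite /w /val; case: ifP; rewrite ?hk.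
rewrite /= /set_cell /val !(fE rest, fE new, fE len) // ck.
split=> //; split=> /=.
- move=> t i ht; rewrite -(fE _ _ ht) /=; move: ht; rewrite !inE !negb_or.
  by case/andP => /negbTE-> /negbTE->.
- move=> i ni; rewrite /set_idx -(hi _ ni) /=.
  by move: ni; rewrite inE => /negbTE ->.
- by move=> i; rewrite ltnS leq_eqVlt; have := hn i; case: (eqVneq i k) => [->|_] /=.
Qed.

(** After a zero is found the variable may move on, but only to another zero. *)
Lemma find_zero_loop v : cell v zero 0 = 0 -> idx v ixouter = K ->
  reaches K (for_loop ixinner find_zero_body) (K * 4 + 2) v (fun v' =>
   [/\ cell v' = cell v, same_idx [:: ixouter; ixinner] v v' &
       (idx v' ixouter = K /\ forall k, (k < K)%N -> cell v offJ k != 0) \/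
       (idx v' ixouter < K)%N /\ cell v offJ (idx v' ixouter) = 0]).
Proof.
move=> z0 oK.
pose Inv n v' :=
   [/\ cell v' = cell v, same_idx [:: ixouter; ixinner] v v' &
       (idx v' ixouter = K /\ forall k, (k < n)%N -> cell v offJ k != 0) \/
       (idx v' ixouter < K)%N /\ cell v offJ (idx v' ixouter) = 0].
have H := @reaches_for R K K_gt0 ixinner find_zero_body 2 Inv v.
apply: reaches_weaken (H _ _ _).
- by [].
- by move=> v' [].
- by [].
- split=> //=; last by left.
  by move=> i; rewrite /set_idx /= !inE !negb_or => /andP[_ /negbTE ->].
move=> k [f g] kK /= h0 hk [/= hc hi ho].
apply: (reaches_denote K_gt0).
  by rewrite /= hk kK K_gt0; split=> //; case: ifP => //; split => //; exact: ltnW.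
rewrite /= hk hc z0; case: eqVneq => ak /=; split=> //; split=> //=.
- move=> i ni; rewrite -(hi _ ni) /set_idx /=.
  by move: ni; rewrite !inE !negb_or => /andP[/negbTE h2 /negbTE h3]; rewrite h3 ?h2.
- by right; rewrite /set_idx /=.
- move=> i ni; rewrite -(hi _ ni) /set_idx /=.
  by move: ni; rewrite !inE !negb_or => /andP[/negbTE h2 /negbTE h3]; rewrite h3 ?h2.
- rewrite /set_idx /=; case: ho => [[gK hn]|h]; [left|by right]; split=> // i.
  by rewrite ltnS leq_eqVlt => /predU1P[->|]; last exact: hn.
Qed.

Lemma nextnE k : (k < K)%N -> nextn k = (k.+1 %% K)%N.
Proof.
move=> kK; rewrite /nextn; case: ltnP => h; first by rewrite modn_small.
by rewrite (_ : k.+1 = K) ?modnn //; lia.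
Qed.

Lemma cut_loop v z : (z < K)%N -> idx v ixnext = z ->
  reaches K (for_loop ixinner cut_body) (K * 6 + 2) v (fun v' =>
    forall k, (k < K)%N ->
      cell v' diagT k = cell v diagJ ((z + k.+1) %% K) /\
      cell v' offT k = cell v offJ ((z + k.+1) %% K)).
Proof.
move=> zK sz.
pose Inv n v' :=
   [/\ same_cells [:: diagT; offT] v v', idx v' ixnext = ((z + n) %% K)%N &
    forall k, (k < n)%N ->
      cell v' diagT k = cell v diagJ ((z + k.+1) %% K) /\
      cell v' offT k = cell v offJ ((z + k.+1) %% K)].
have H := @reaches_for R K K_gt0 ixinner cut_body 4 Inv v.
apply: reaches_weaken (H _ _ _).
- by [].
- by move=> v' [_ []].
- by [].
- by split=> //=; rewrite /set_idx /= sz addn0 modn_small.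
move=> k [f g] kK /= h0 hk [/= hc hs hn].
have lts : (g 4%N < K)%N by rewrite hs ltn_mod.
apply: (@reaches_seq _ _ _ _ 2 2).
  exact: reaches_set_succ.
move=> _ ->; set g' := set_idx _ _ _.
have g3 : g' 3%N = k by exact: hk.
have g4 : g' 4%N = ((z + k.+1) %% K)%N.
  by rewrite /g' /set_idx /= nextnE // hs -addn1 modnDml addn1 -addnS.
clearbody g'.
have lt4 : (g' 4%N < K)%N by rewrite g4 ltn_mod.
apply: (reaches_denote K_gt0).
  by rewrite /= g3 kK lt4; do ![split=> //].
have fE t i : t \notin [:: diagT; offT] -> f t i = cell v t i by apply: hc.
rewrite /= /set_cell /= g3 g4 !(fE diagJ, fE offJ) //.
split=> //; split=> //=.
- move=> t i ht; rewrite -(fE _ _ ht) /=; move: ht; rewrite !inE !negb_or.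
  by case/andP => /negbTE-> /negbTE->.
- by move=> i; rewrite ltnS leq_eqVlt; case: eqVneq => [->|_] //=; exact: hn.
Qed.

End Loops.

(** * Correctness of the program *)

Section Program.
Variables (R : realType) (K : nat) (hK : (3 <= K)%N).
Variables (a b : 'I_K -> R) (neg : bool).
Let K_gt0 : (0 < K)%N. Proof. by apply: leq_trans hK. Qed.
Implicit Types (v : view R) (s : state R).

Let M := ((num_arrays + num_vars) * K)%N.

(** The input is written by a fold over all indices; a cell is defined as soon
    as its index has been met. *)
Lemma input_cell t k : (rmem (input a b neg)).[? (t, k)] =
  if insub k is Some i then
    if t == 0%N then Some (a i) else if t == 1%N then Some (b i) else None
  else None.
Proof.
have H (l : seq 'I_K) : (foldr (fun (i : 'I_K) m =>
      m.[(0%N, val i) <- a i].[(1%N, val i) <- b i]) [fmap] l).[? (t, k)] =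
  if insub k is Some i then
    if i \in l then
      if t == 0%N then Some (a i) else if t == 1%N then Some (b i) else None
    else None
  else None.
  elim: l => [|j l IH] /=.
    by rewrite fnd_fmap0; case: insubP.
  rewrite !fnd_set !xpair_eqE IH; case: insubP => [i _ ik|nk]; last first.
    have -> : (k == j) = false by apply/eqP => kj; rewrite kj ltn_ord in nk.
    by rewrite !andbF.
  rewrite -ik (inj_eq val_inj) inE; case: (eqVneq i j) => [->|_] /=.
    by rewrite !andbT; case: (t) => [|[|u]] //=; case: ifP.
  by rewrite !andbF.
rewrite /input /= H; case: insubP => // i _ _.
by rewrite mem_enum.
Qed.

(** What storage bounds need while the work arrays are still being filled and
    the state has no view yet. *)
Definition bounded s :=
  (forall t k, (rmem s).[? (t, k)] -> (t < num_arrays)%N && (k < K)%N) /\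
  (forall i n, (imem s).[? i] = Some n -> (i < num_vars)%N /\ (n <= K)%N).

Lemma bounded_fits s : bounded s -> fits M s.
Proof.
move=> [hr hi]; apply: fits_bounded => //.
- by move=> t k; rewrite -fndSome; exact: hr.
- move=> i; rewrite -fndSome; case E: (_.[? _]) => [n|] // _.
  by have [] := hi _ _ E.
- by move=> i n /hi [].
Qed.

Lemma bounded_idx s i n : (i < num_vars)%N -> (n <= K)%N -> bounded s ->
  bounded (State (rmem s) (imem s).[i <- n]).
Proof.
move=> iN nK [hr hi]; split=> //= j m; rewrite fnd_set.
by case: eqP => [-> [<-]|_]; last exact: hi.
Qed.

Lemma bounded_cell s t k u : (t < num_arrays)%N -> (k < K)%N -> bounded s ->
  bounded (State (rmem s).[(t, k) <- u] (imem s)).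
Proof.
move=> tN kK [hr hi]; split=> //= t' k'; rewrite fnd_set xpair_eqE.
by move: (hr t' k'); case: eqP => [->|_] /=; [case: eqP => [->|_]|]; rewrite ?tN ?kK.
Qed.

Lemma bounded_input : bounded (input a b neg).
Proof.
split=> [t k|i n].
  rewrite input_cell; case: insubP => // i _ <-; rewrite ltn_ord andbT.
  by case: t => [|[|t]].
rewrite /= !fnd_set fnd_fmap0; case: eqP => [-> [<-]|_].
  by split=> //; apply: leq_trans (ltnW hK); case: neg.
by case: eqP => [-> [<-]|].
Qed.

Lemma clear_row_within (l : seq nat) n s : {in l, forall t, (t < num_arrays)%N} ->
  (n < K)%N -> bounded s -> (imem s).[? ixinner] = Some n ->
  within M (clear_row l) (size l) s (fun s' =>
    [/\ bounded s', imem s' = imem s & forall t k, (rmem s').[? (t, k)] =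
      if (t \in l) && (k == n) then Some 0 else (rmem s).[? (t, k)]]).
Proof.
move=> hl nK bs hn; elim: l s hl bs hn => [|t l IH] s hl bs hn.
  by apply: within_skip.
have tN : (t < num_arrays)%N by apply: hl; rewrite mem_head.
have bs' := bounded_cell 0 tN nK bs.
apply: (@within_seq _ _ _ _ 1 (size l)).
apply: (@within_do _ _ _ _ _ _ _ (bounded_fits bs')).
  by rewrite /= /rwrite /= hn.
apply: within_weaken (leqnn _) _ (IH _ _ bs' hn); last first.
  by move=> u ul; apply: hl; rewrite inE ul orbT.
move=> s' [bs'' im rm]; split=> // u k; rewrite rm inE /= fnd_set xpair_eqE.
by case: (u \in l) (k == n) (u == t) => [] [] [].
Qed.

Definition loaded (f : 'I_K -> R) v :=
  [/\ forall i : 'I_K, cell v offJ i = f i, forall i : 'I_K, cell v diagJ i = b i &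
      forall t k, t \in work_arrays -> (k < K)%N -> cell v t k = 0].

(** Row k of the work arrays is cleared in round k, so that between rounds the
    defined cells are those of the input and the first k rows. *)
Lemma init_within : within M init (K * 17 + 6) (input a b neg) (fun s =>
  exists2 v, represents K s v & loaded a v /\ idx v ixsign = neg).
Proof.
have step i s N c (Q : state R -> Prop) : (i < num_vars)%N -> bounded s ->
    (bounded (State (rmem s) (imem s).[i <- 0%N]) ->
     within M c N (State (rmem s) (imem s).[i <- 0%N]) Q) ->
    within M (Seq (Do (ISet i (IConst 0))) c) N.+1 s Q.
  move=> iN bs h; rewrite -add1n; apply: within_seq.
  have bs' := bounded_idx iN (leq0n K) bs.
  by apply: within_do (bounded_fits bs') (h bs').
rewrite (_ : K * 17 + 6 = (K * 17 + 2).+4)%N; last by lia.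
apply: (step ixouter _ _ _ _ isT bounded_input) => b1.
apply: (step ixinner _ _ _ _ isT b1) => b2.
apply: (step ixnext _ _ _ _ isT b2) => b3.
apply: (step ixprev _ _ _ _ isT b3) => b4.
set s4 := State _ _ in b4 *.
pose Inv n s := [/\ bounded s,
  forall i, (imem s).[? i] = (imem s4).[ixinner <- n].[? i] &
  forall t k, (rmem s).[? (t, k)] =
    if (t \in work_arrays) && (k < n)%N then Some 0
    else (rmem (input a b neg)).[? (t, k)]].
rewrite -[(K * 17 + 2)%N]addn0; apply: within_seq.
apply: within_weaken (leqnn _) _ (@within_for _ M ixinner _ 16 K Inv s4 _ _ _ _).
- move=> s [bs im rm]; apply: within_skip.
  exists (View (fun t k => odflt 0 (rmem s).[? (t, k)])
               (fun i => odflt 0%N (imem s).[? i])).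
    split=> /=.
    + move=> t k; case E: (_ && _); last first.
        case F: (_.[? _]) => [u|] //.
        by have := bs.1 t k; rewrite F E => /(_ isT).
      have /andP[tN kK] := E.
      have : (rmem s).[? (t, k)] : bool; last by case: (_.[? _]).
      rewrite rm kK andbT; case: ifP => //.
      rewrite input_cell insubT => //; case: t tN {E} => [|[|t]] //= tN.
      by rewrite mem_iota -ltnS => /negP; case; exact: tN.
    + move=> i; rewrite im /= !fnd_set fnd_fmap0.
      by case: i => [|[|[|[|[|[|i]]]]]].
    + move=> i; case E: (_.[? _]) => [n|] //=.
      by have [] := bs.2 _ _ E.
    + by rewrite im /= !fnd_set.
  split; last by rewrite /= im /= !fnd_set.
  split=> /= [i|i|t k tw kK]; last by rewrite rm tw kK.
    by rewrite rm /= input_cell valK.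
  by rewrite rm /= input_cell valK.
- apply: bounded_fits; exact: (@bounded_idx s4).
- split=> //=; first exact: (@bounded_idx s4).
  by move=> t k; rewrite ltn0 andbF.
- move=> k s kK [_ im _]; rewrite !im /= !fnd_set //=.
- move=> k s kK [bs im rm].
  apply: (@within_seq _ _ _ _ 15 1).
  have hk : (imem s).[? ixinner] = Some k by rewrite im fnd_set eqxx.
  have hl : {in work_arrays, forall t, (t < num_arrays)%N}.
    by move=> t; rewrite mem_iota => /andP[].
  apply: within_weaken (leqnn _) _ (clear_row_within hl kK bs hk).
  move=> s' [bs' im' rm'].
  have bs2 := @bounded_idx s' ixinner k.+1 isT kK bs'.
  apply: within_do (bounded_fits bs2) _.
    by rewrite /= im' hk addn1.
  split=> //=.
    move=> i; rewrite im' -/(imem s4) [LHS]fnd_set im [RHS]fnd_set fnd_set.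
    by case: eqP.
  move=> t i; rewrite rm' ltnS leq_eqVlt rm; case: (t \in work_arrays) => //=.
  by case: eqP.
Qed.

Let J := Jmx a b neg.
Let c := cyclic_offdiag a neg.

(** The result arrays hold the two diagonals of a matrix T as required. *)
Definition solved v := exists T : 'M[R]_K,
  [/\ symmetric_mx T, tridiagonal T, orthogonally_similar T J,
      forall i : 'I_K, cell v diagT i = T i i &
      forall i j : 'I_K, j = i.+1 :> nat -> cell v offT i = T i j].

Lemma fix_sign_reaches v : loaded a v -> idx v ixsign = neg ->
  reaches K fix_sign 2 v (loaded c).
Proof.
move=> [la lb lz] ns; apply: (reaches_order) => h0.
have K1 : (K - 1 < K)%N by lia.
apply: (reaches_denote K_gt0).
  by rewrite /= h0 ns; split=> //; case: ifP => // _; rewrite K1 K_gt0; split.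
rewrite /= ns /=; split.
- move=> i; rewrite /c /cyclic_offdiag -la.
  case: (neg) => /=; last by rewrite expr0 mul1r; case: ifP.
  rewrite /set_cell /= h0 subn1 (lz zero) //.
  by case: eqVneq => [->|_] //; rewrite sub0r expr1 mulN1r.
- by move=> i; rewrite -lb; case: ifP.
- move=> t k tw kK; rewrite -(lz t k) //; case: ifP => //= _.
  by rewrite /set_cell; case: eqP tw => [->|].
Qed.

Lemma cut_reaches v : loaded c v -> (idx v ixouter < K)%N ->
  cell v offJ (idx v ixouter) = 0 -> reaches K cut (K * 6 + 3) v solved.
Proof.
move=> [lc lb lz] zK cz.
rewrite (_ : K * 6 + 3 = 1 + (K * 6 + 2))%N; last by lia.
pose v1 := View (cell v) (set_idx (idx v) ixnext (idx v ixouter)).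
apply: (reaches_seq (Q := fun v' => v' = v1)).
  by apply: (reaches_denote K_gt0) => //=; split=> //; exact: ltnW.
move=> _ ->; have H := @cut_loop R K hK v1 _ zK erefl.
apply: reaches_weaken (leqnn _) _ H => v' H.
pose z := Ordinal zK; have cz' : c z = 0 by rewrite -lc.
exists (cut_mx a b neg z); split.
- exact: cut_mx_sym.
- exact: cut_mx_tridiagonal.
- exact: cut_mx_similar.
- move=> i; have [-> _] := H i (ltn_ord i).
  by rewrite cut_mx_diag // -lb val_after.
- move=> i j ij; have [_ ->] := H i (ltn_ord i).
  by rewrite cut_mx_superdiag // -/c -lc val_after.
Qed.

Definition row_of v t : 'rV[R]_K := \row_k cell v t k.

Lemma dot_cells (f g : nat -> R) :
  \sum_(0 <= k < K) f k * g k = dot (\row_(k < K) f k) (\row_(k < K) g k).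
Proof.
by rewrite big_mkord dotE; apply: eq_bigr => k _; rewrite !mxE.
Qed.

Definition data v :=
  (forall i : 'I_K, cell v offJ i = c i) /\ (forall i : 'I_K, cell v diagJ i = b i).

(** Column k of J is nonzero only at k and at its two cyclic neighbours. *)
Lemma residual_row v : data v ->
  \row_k residual_entry K v k =
    row_of v cur *m J - cell v beta 0 *: row_of v prv.
Proof.
move=> [lc lb]; apply/rowP => k; rewrite !mxE -/J.
have := mulmx_Jmx a b neg hK (row_of v cur) k; rewrite mxE => ->.
have hS : ordS k = nextn K k :> nat.
  rewrite -[LHS]/(val (ordS k)) (val_ordS hK) /nextn; move: (ltn_ord k).
  by move=> kK; case: eqP; case: ltnP => //; lia.
have hP : ord_pred k = prevn K k :> nat := val_ord_pred hK k.
by rewrite /row_of !mxE -/c -!lc -lb hS hP.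
Qed.

Lemma same_row l v v' t :
  same_cells l v v' -> t \notin l -> row_of v' t = row_of v t.
Proof. by move=> h tl; apply/rowP => k; rewrite !mxE h. Qed.

Lemma orthogonalize_reaches v : data v ->
  let q := row_of v cur in
  let u := q *m J - cell v beta 0 *: row_of v prv in
  let w := u - dot u q *: q in
  let r := row_of v rest - dot (row_of v rest) q *: q in
  reaches K orthogonalize (K * 28 + 8) v (fun v' =>
    [/\ same_cells [:: rest; new; alpha; rho; newsq; remsq; tmp1; tmp2] v v',
        same_idx [:: ixinner; ixnext; ixprev] v v',
        cell v' alpha 0 = dot u q,
        row_of v' new = w /\ row_of v' rest = r &
        cell v' newsq 0 = dot w w /\ cell v' remsq 0 = dot r r]).
Proof.
move=> [lc lb] q u w r.
pose v1 := View (set_cell (set_cell (set_cell (set_cell (cell v)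
  alpha 0 0) rho 0 0) newsq 0 0) remsq 0 0) (idx v).
have v1E t k : t \notin [:: alpha; rho; newsq; remsq] -> cell v1 t k = cell v t k.
  rewrite !inE !negb_or => /and4P[/negbTE h1 /negbTE h2 /negbTE h3 /negbTE h4].
  by rewrite /= /set_cell h1 h2 h3 h4.
rewrite (_ : K * 28 + 8 = 4 + ((K * 18 + 2) + ((K * 10 + 2) + 0)))%N; last by lia.
apply: (reaches_seq (Q := fun v' => v' = v1)).
  apply: (reaches_denote K_gt0) => //=; by rewrite K_gt0.
move=> _ ->.
have z1 : cell v1 alpha 0 = 0 by [].
have z2 : cell v1 rho 0 = 0 by [].
have z3 : cell v1 newsq 0 = 0 by [].
have z4 : cell v1 remsq 0 = 0 by [].
have i1 : idx v1 = idx v by [].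
clearbody v1.
apply: (reaches_seq (residual_loop hK z1 z2)) => // v2 [c2 i2 n2 a2 r2].
have q1 : row_of v1 cur = q by apply/rowP => k; rewrite !mxE v1E.
have d1 : data v1 by split=> k; rewrite v1E.
have u2 : row_of v2 new = u.
  rewrite /u -q1 -(v1E beta) // (_ : row_of v prv = row_of v1 prv); last first.
    by apply/rowP => k; rewrite !mxE v1E.
  by rewrite -(residual_row d1); apply/rowP => k; rewrite !mxE n2.
have q2 : row_of v2 cur = q by rewrite -q1 (same_row c2).
have al2 : cell v2 alpha 0 = dot u q.
  rewrite a2 dot_cells -/(row_of v1 cur) q1 -u2; congr (dot _ _).
  by apply/rowP => k; rewrite !mxE n2.
have rh2 : cell v2 rho 0 = dot (row_of v rest) q.
  rewrite r2 dot_cells -/(row_of v1 cur) q1; congr (dot _ _).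
  by apply/rowP => k; rewrite !mxE v1E.
apply: (reaches_seq (project_loop hK _ _)); try by rewrite c2.
move=> v3 [c3 i3 n3 w3 r3].
apply: (reaches_denote K_gt0) => //=.
have w3E : \row_(k < K) new_entry v2 k = w.
  rewrite /w -al2 -u2 -q2; apply/rowP => k; by rewrite !mxE.
have r3E : \row_(k < K) rem_entry v2 k = r.
  rewrite /r -rh2 -q2; apply/rowP => k; rewrite !mxE /rem_entry c2 // v1E //.
split.
- by move=> t k tn; rewrite c3 ?c2 ?v1E //; exact: notin_sub tn _.
- by move=> i ni; rewrite i3 ?i2 ?i1 //; exact: notin_sub ni _.
- by rewrite c3.
- split; [rewrite -w3E | rewrite -r3E]; apply/rowP => k; rewrite !mxE;
    by have [] := n3 k (ltn_ord k).
- by rewrite w3 r3 !dot_cells w3E r3E.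
Qed.

(** At a breakdown the off-diagonal entry is 0 but the divisor is the norm of
    the restart vector; otherwise both are the norm of the residual. *)
Lemma choose_length_reaches v : (idx v ixouter < K)%N -> cell v zero 0 = 0 ->
  0 <= cell v newsq 0 -> 0 <= cell v remsq 0 ->
  let brk := cell v newsq 0 == 0 in
  let d := Num.sqrt (if brk then cell v remsq 0 else cell v newsq 0) in
  let bet := if brk then 0 else d in
  reaches K choose_length 4 v (fun v' =>
   [/\ same_cells [:: offT; beta; len] v v', idx v' = idx v,
      cell v' len 0 = d, cell v' beta 0 = bet &
      forall k, cell v' offT k = if k == idx v ixouter then bet else cell v offT k]).
Proof.
move=> oK z0 n0 r0 brk d bet.
apply: (reaches_denote K_gt0).
  rewrite /= z0 -/brk; case: (brk); rewrite /= /set_cell /= ?oK ?K_gt0;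
  by do ![split=> //].
rewrite /= z0 -/brk /bet /d; case: (brk); rewrite /= /set_cell /=; split=> //=.
- move=> t k; rewrite !inE !negb_or => /and3P[/negbTE h1 /negbTE h2 /negbTE h3].
  by rewrite /= h1 h2 h3.
- move=> t k; rewrite !inE !negb_or => /and3P[/negbTE h1 /negbTE h2 /negbTE h3].
  by rewrite /= h1 h2 h3.
Qed.

Hypothesis c_neq0 : forall i, c i != 0.

Let i0 : 'I_K := Ordinal K_gt0.
Let i1 : 'I_K := Ordinal (ltn_trans (ltnSn 1) hK).
Let e0 : 'rV[R]_K := delta_mx 0 i0.
Let e1 : 'rV[R]_K := delta_mx 0 i1.

Lemma Je_cyclic : cyclic_pair J e0 e1.
Proof. exact: Jmx_cyclic_pair. Qed.

(** Only the last two of the vectors v_i are in memory; the others exist as a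
    witness in the invariant. *)
Definition lanczos_state j v := exists vs : nat -> 'rV[R]_K,
  [/\ data v, cell v zero 0 = 0 &
    if (j < K)%N
    then lanczos_inv J e0 e1 j vs (cell v diagT) (cell v offT)
           (row_of v cur) (row_of v prv) (row_of v rest) (cell v beta 0)
    else lanczos_done J vs (cell v diagT) (cell v offT)].

(** The results stored for earlier steps are left untouched, so the invariant
    moves from one step to the next by [lanczos_step]; the last step stores its
    diagonal entry and stops by [lanczos_last]. *)
Lemma lanczos_body_reaches j v : (j < K)%N -> idx v 0 = K -> idx v ixouter = j ->
  lanczos_state j v ->
  reaches K lanczos_body (K * 33 + 16) v (fun v' =>
    idx v' ixouter = j /\ lanczos_state j.+1 v').
Proof.
move=> jK h0 hj [vs [dv zv]]; rewrite jK => inv.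
rewrite (_ : K * 33 + 16 = (K * 28 + 8) + (1 + ((4 + (K * 5 + 2)).+1 + 0)))%N;
  last by lia.
apply: reaches_seq (orthogonalize_reaches dv) _ => v1 [].
set q := row_of v cur; set u := q *m J - _; set w := u - _; set r := _ - _ *: q.
move=> c1 i1' al1 [w1 r1] [ws1 rs1].
pose v2 := View (set_cell (cell v1) diagT j (dot u q)) (idx v1).
have c2 t k : t != diagT -> cell v2 t k = cell v1 t k.
  by move=> /negbTE h; rewrite /= /set_cell h.
have d2 k : cell v2 diagT k = if k == j then dot u q else cell v diagT k.
  by rewrite /= /set_cell /= c1.
have ix2 i : i \notin [:: ixinner; ixnext; ixprev] -> idx v2 i = idx v i.
  exact: i1'.
apply: (reaches_seq (Q := fun v' => v' = v2)).
  apply: (reaches_denote K_gt0); rewrite /= i1' // hj; last by rewrite al1.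
  by rewrite jK K_gt0; split.
move=> _ ->; clearbody v2.
apply: (@reaches_seq _ _ _ _ _ 0 _
  (fun v' => idx v' ixouter = j /\ lanczos_state j.+1 v')); last first.
  by move=> v' st; apply: (reaches_denote K_gt0).
apply: reaches_if => //=.
rewrite !ix2 // hj h0 addn1.
have data2 : data v2 by case: (dv) => dvJ dvb; split=> k; rewrite c2 // c1.
have z2 : cell v2 zero 0 = 0 by rewrite c2 // c1.
case: ltnP => [jK'|Kj]; last first.
  apply: (@reaches_weaken _ _ Skip 0 _ v2 (fun v' => v' = v2)) => //; last first.
    exact: (reaches_denote K_gt0).
  move=> _ ->; rewrite ix2 //; split=> //; exists vs; split=> //.
  rewrite ltnNge Kj /=.
  apply: (lanczos_last inv) => //; first by lia.
  - by move=> i ij; rewrite d2 (ltn_eqF ij).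
  - by rewrite d2 eqxx.
  - by move=> i ij; rewrite c2 // c1.
have ws2 : cell v2 newsq 0 = dot w w by rewrite c2.
have rs2 : cell v2 remsq 0 = dot r r by rewrite c2.
have w2 : row_of v2 new = w by rewrite -w1; apply/rowP => k; rewrite !mxE c2.
have r2 : row_of v2 rest = r by rewrite -r1; apply/rowP => k; rewrite !mxE c2.
have q2 : row_of v2 cur = q by apply/rowP => k; rewrite !mxE c2 ?c1.
have o2 k : cell v2 offT k = cell v offT k by rewrite c2 ?c1.
apply: reaches_seq (choose_length_reaches _ z2 _ _) _.
- by rewrite ix2 ?hj.
- by rewrite ws2 dot_ge0.
- by rewrite rs2 dot_ge0.
rewrite ws2 rs2 => v3 [c3 ix3 len3 bet3 off3].
have step (al be : nat -> R) :=
  @lanczos_step _ _ _ _ _ (Jmx_sym a b neg hK) _ _ _ _ _ _ _ _ inv al be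
    Je_cyclic jK'.
have al3 i : (i < j)%N -> cell v2 diagT i = cell v diagT i.
  by move=> ij; rewrite d2 (ltn_eqF ij).
have be3 i : (i < j)%N -> cell v3 offT i = cell v offT i.
  by move=> ij; rewrite off3 ix2 // hj (ltn_eqF ij) o2.
have al3j : cell v2 diagT j = dot u q by rewrite d2 eqxx.
have be3j : cell v3 offT j = cell v3 beta 0 by rewrite off3 bet3 ix2 // hj eqxx.
have [len0 _] := step _ _ al3 al3j be3 (etrans be3j bet3).
rewrite -/q -/u -/w -/r -len3 in len0.
apply: reaches_weaken (leqnn _) _ (advance_loop hK len0) => v4 [c4 ix4 n4].
split; first by rewrite ix4 // ix3 ix2 // hj.
have al4 i : cell v4 diagT i = cell v2 diagT i by rewrite c4 // c3.
have be4 i : cell v4 offT i = cell v3 offT i by rewrite c4.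
have [] := step (cell v4 diagT) (cell v4 offT).
- by move=> i ij; rewrite al4 al3.
- by rewrite al4 al3j.
- by move=> i ij; rewrite be4 be3.
- by rewrite be4 be3j bet3.
rewrite -/q -/u -/w -/r -len3 => _.
have -> : (if dot w w == 0 then 0 else cell v3 len 0) = cell v3 beta 0.
  by rewrite bet3 len3; case: ifP.
set q' := \row_k _; set vs' := fun i => _.
move=> inv'; exists vs'; split.
- by case: data2 => dJ db; split=> k; rewrite c4 // c3.
- by rewrite c4 // c3.
rewrite jK' c4 //.
have -> : row_of v4 cur = q'.
  apply/rowP => k; rewrite !mxE; have [_ ->] := n4 k (ltn_ord k).
  rewrite (c3 newsq) // (c3 zero) // (c3 rest) // (c3 new) // ws2 z2.
  by congr (_ / _); case: ifP; rewrite -?w2 -?r2 mxE.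
have -> : row_of v4 prv = q.
  apply/rowP => k; rewrite -q2 !mxE; have [-> _] := n4 k (ltn_ord k).
  by rewrite c3.
have -> : row_of v4 rest = r.
  by rewrite -r2; apply/rowP => k; rewrite !mxE c4 // c3.
exact: inv'.
Qed.

Lemma lanczos_reaches v : loaded c v ->
  reaches K lanczos (K * (K * 33 + 18) + 4) v solved.
Proof.
move=> [lc lb lz].
have one_lt : (1 < K)%N := ltn_trans (ltnSn 1) hK.
pose v1 := View (set_cell (set_cell (cell v) cur 0 1) rest 1 1) (idx v).
rewrite (_ : K * (K * 33 + 18) + 4 = 1 + (1 + ((K * (K * 33 + 18) + 2) + 0)))%N;
  last by lia.
apply: (reaches_seq (Q := fun v' => v' = View (set_cell (cell v) cur 0 1) (idx v))).
  by apply: (reaches_denote K_gt0).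
move=> _ ->; apply: (reaches_seq (Q := fun v' => v' = v1)).
  by apply: (reaches_denote K_gt0) => //=.
move=> _ ->.
have cur1 : row_of v1 cur = e0.
  apply/rowP => k; rewrite !mxE /= /set_cell /= lz //.
  by rewrite -(inj_eq val_inj k) /=; case: eqP.
have res1 : row_of v1 rest = e1.
  apply/rowP => k; rewrite !mxE /= /set_cell /= lz //.
  by rewrite -(inj_eq val_inj k) /=; case: eqP.
have H := @reaches_for R K K_gt0 ixouter lanczos_body (K * 33 + 16) lanczos_state v1.
apply: (@reaches_seq _ _ _ _ _ 0 _ solved); last first.
  by move=> v' st; apply: (reaches_denote K_gt0).
apply: reaches_weaken (H _ _ _).
- by rewrite (_ : (K * 33 + 16).+2 = K * 33 + 18)%N //; lia.
- move=> v' [_ [vs [_ _]]]; rewrite ltnn => fin.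
  have Tsym := run_matrix_sym (Jmx_sym a b neg hK) vs.
  exists ((run_basis vs)^T *m J *m run_basis vs); split=> //.
  + move=> i j far; have [ij|ji] : (i.+1 < j)%N \/ (j.+1 < i)%N by lia.
      exact: (run_matrix_far fin).
    by rewrite -Tsym mxE (run_matrix_far fin).
  + exists (run_basis vs); split=> //; exact: (run_basis_orthogonal fin).
  + by move=> i; rewrite (run_matrix_diag fin).
  + by move=> i j ij; rewrite (run_matrix_superdiag fin).
- by [].
- have b1 : cell v1 beta 0 = 0 by rewrite -(lz beta 0%N).
  exists (fun=> e0); split; [by split|by rewrite -(lz zero 0%N)|].
  rewrite K_gt0; change (lanczos_inv J e0 e1 0 (fun=> e0) (cell v1 diagT)
    (cell v1 offT) (row_of v1 cur) (row_of v1 prv) (row_of v1 rest)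
    (cell v1 beta 0)).
  rewrite cur1 res1 b1; apply: lanczos_start.
  by rewrite dot_delta mxE !eqxx.
- move=> k v2 kK h0 hk st.
  exact: lanczos_body_reaches.
Qed.

End Program.

Theorem mainTheorem2 :
  exists (p : cmd) (Cops Cmem : nat),
    forall (R : realType) (K : nat) (hK : (3 <= K)%N)
           (a b : 'I_K -> R) (neg : bool),
    exists (n : nat) (s : state R) (T : 'M[R]_K),
      [/\ runs (Cmem * K) p (input a b neg) n s,
          (n <= Cops * K ^ 2)%N
        & outputs s T] /\
      [/\ symmetric_mx T,
          tridiagonal T,
          orthogonally_similar T (Jmx a b neg),
          (forall x : R, eigenvalue T x = eigenvalue (Jmx a b neg) x)
        & char_poly T = char_poly (Jmx a b neg)].
Proof.
(* At most 33 K^2 + 45 K + 16 operations are made; 100 leaves a margin. *)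
exists tridiagonalize, 100, (num_arrays + num_vars)%N.
move=> R K hK a b neg.
have K_gt0 : (0 < K)%N by apply: leq_trans hK.
have run v : loaded b a v /\ idx v ixsign = neg ->
    reaches K (seqs [:: fix_sign; find_zero;
      If (ILt (IVar ixouter) (IVar ixorder)) cut lanczos])
      (2 + ((1 + (K * 4 + 2)) + ((K * (K * 33 + 18) + K * 6 + 4).+1 + 0))) v
      (solved a b neg).
  move=> [la sv].
  apply: (reaches_seq (fix_sign_reaches hK la sv)) => v1 l1.
  pose v2 := View (cell v1) (set_idx (idx v1) ixouter (idx v1 0)).
  have [lc lb lz] := l1.
  apply: (reaches_seq (Q := fun v' => [/\ cell v' = cell v1 &
       (idx v' ixouter = K /\ forall k, (k < K)%N -> cell v1 offJ k != 0) \/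
       (idx v' ixouter < K)%N /\ cell v1 offJ (idx v' ixouter) = 0])).
    apply: reaches_order => h0.
    apply: (reaches_seq (Q := fun v' => v' = v2)).
      by apply: (reaches_denote K_gt0) => //=; rewrite h0; split.
    move=> _ ->; have H := @find_zero_loop R K hK v2 (lz zero 0%N isT K_gt0) h0.
    by apply: reaches_weaken (leqnn _) _ H => v' [].
  move=> v3 [c3 z3].
  have l3 : loaded b (cyclic_offdiag a neg) v3 by rewrite /loaded c3.
  apply: (@reaches_seq _ _ _ _ _ 0 _ (solved a b neg)); last first.
    by move=> v' st; apply: (reaches_denote K_gt0).
  apply: reaches_order => h0; apply: reaches_if => //=; rewrite h0.
  case: z3 => [[-> nz]|[lt cz]].
    rewrite ltnn.
    have nz' (i : 'I_K) : cyclic_offdiag a neg i != 0 by rewrite -lc nz.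
    apply: reaches_weaken (lanczos_reaches hK nz' l3) => //; lia.
  rewrite lt -c3 in cz *.
  by apply: reaches_weaken (cut_reaches hK l3 lt cz) => //; lia.
have init := init_within hK a b neg.
have [n [s [nN ex [v rep [T [sT tT simT dT oT]]]]]] :
  within ((num_arrays + num_vars) * K) tridiagonalize
   ((K * 17 + 6) +
      (2 + ((1 + (K * 4 + 2)) + ((K * (K * 33 + 18) + K * 6 + 4).+1 + 0))))
   (input a b neg) (fun s => exists2 v, represents K s v & solved a b neg v).
  apply: within_seq; apply: within_weaken (leqnn _) _ init => s [v rep lv].
  exact: run lv s rep.
exists n, s, T; split; split=> //.
- by split=> //; apply: bounded_fits => //; exact: bounded_input.
- by apply: leq_trans nN _; nia.
- split=> [i|i j ij].
    by rewrite (rep_cell rep) ltn_ord dT.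
  by rewrite (rep_cell rep) ltn_ord (oT i j).
- by move=> x; exact: orthogonally_similar_eigenvalue.
- exact: orthogonally_similar_char_poly.
Qed.
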